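(* For every real $\alpha\ge 1$ there is a constant $A_\alpha$, depending on $\alpha$ but not on $n$, such that for all integers $n\ge 2$ and all real $x_0$, \[ \left| P_{\alpha}\left( W_{\alpha}\le x_0\right) - \frac{1}{\sqrt{2\pi}}\int_{-\infty}^{x_0} e^{-x^2/2}\,dx\right| \le A_\alpha\, n^{-1/4}, \] where $W_\alpha(\lambda)=\dfrac{\alpha\, n(\lambda')-n(\lambda)}{\sqrt{\alpha\binom{n}{2}}}$ and $P_\alpha$ denotes probability when $\lambda$ is a random partition of $n$ chosen from Jack$_\alpha$ measure.
   Context: Partitions of $n$ are identified with their Young diagrams (row $i$ has $\lambda_i$ boxes). For a box $s$ of $\lambda$, the arm $a(s)$ is the number of boxes in the same row as $s$ and to the right of $s$; the leg $l(s)$ is the number of boxes in the same column as $s$ and below $s$. For $\alpha>0$, Jack$_\alpha$ measure on partitions of $n$ chooses $\lambda$ with probability \[ \pi_\alpha(\lambda)=\frac{\alpha^n n!}{\prod_{s\in\lambda}(\alpha a(s)+l(s)+1)(\alpha a(s)+l(s)+\alpha)}. \] For a partition $\lambda=(\lambda_1\ge\lambda_2\ge\cdots)$, $n(\lambda)=\sum_{i\ge1}(i-1)\lambda_i$, and $\lambda'$ is the conjugate (transposed) partition. *)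

(* Defs.v *)
From HB Require Import structures.
From mathcomp Require Import all_boot all_order all_algebra.
From mathcomp Require Import all_classical all_reals all_analysis.

Set Implicit Arguments.
Unset Strict Implicit.
Unset Printing Implicit Defensive.

Import Order.TTheory GRing.Theory Num.Theory.
Import numFieldNormedType.Exports.

Local Open Scope nat_scope.

Definition is_partition (n : nat) (s : seq nat) : bool :=
  [&& sorted geq s, 0 \notin s & sumn s == n].

(* The part lambda_i (i >= 1) is [nth 0 la i.-1]; it is 0 beyond the last row. *)
Record intpart (n : nat) := IntPart {
  parts :> seq nat;
  parts_partition : is_partition n parts
}.

HB.instance Definition _ n := [isSub for @parts n].
HB.instance Definition _ n := [Equality of intpart n by <:].
HB.instance Definition _ n := [Choice of intpart n by <:].
HB.instance Definition _ n := [Countable of intpart n by <:].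

Section IntpartFinite.
Variable n : nat.
Implicit Type la : intpart n.

Lemma intpart_sum la : sumn la = n.
Proof. by case: la => s /= /and3P[_ _ /eqP]. Qed.

Lemma intpart_sorted la : sorted geq la.
Proof. by case: la => s /= /and3P[]. Qed.

Lemma intpart_gt0 la r : r \in (la : seq nat) -> 0 < r.
Proof.
case: la => s /= /and3P[_ s0 _] rs; rewrite lt0n.
by apply: contraNneq s0 => <-.
Qed.

Lemma intpart_le la r : r \in (la : seq nat) -> r <= n.
Proof.
rewrite -[n in _ <= n](intpart_sum la).
elim: (la : seq nat) => //= a s IH; rewrite inE => /orP[/eqP->|/IH rs].
  exact: leq_addr.
exact: leq_trans rs (leq_addl _ _).
Qed.

Lemma intpart_size la : size la <= n.
Proof.
rewrite -[n in _ <= n](intpart_sum la).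
have := @intpart_gt0 la; elim: (la : seq nat) => //= a s IH s0.
rewrite -add1n leq_add ?s0 ?mem_head// IH// => r rs.
by apply: s0; rewrite inE rs orbT.
Qed.

Definition intpart_code la : n.-bseq 'I_n.+1 :=
  insub_bseq n [seq inord r | r <- la].
Definition intpart_decode (b : n.-bseq 'I_n.+1) : option (intpart n) :=
  insub [seq nat_of_ord i | i <- b].

Lemma intpart_codeK : pcancel intpart_code intpart_decode.
Proof.
move=> la; rewrite /intpart_decode /intpart_code /insub_bseq.
rewrite insubdK ?unfold_in/= ?size_map ?intpart_size// -map_comp.
rewrite map_id_in ?valK// => r rla /=.
by rewrite inordK// ltnS (intpart_le rla).
Qed.

End IntpartFinite.

HB.instance Definition _ n :=
  fintype.isFinite.Build (intpart n) (pcan_enumP (@intpart_codeK n)).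

(* The Young diagram, as a set of boxes (row, column) counted from 0; rows and
   columns of a partition of n have indices < n, so no box is lost. *)
Definition diagram (n : nat) (la : intpart n) : {set 'I_n * 'I_n} :=
  [set s : 'I_n * 'I_n | s.2 < nth 0 la s.1].

Definition arm (n : nat) (la : intpart n) (s : 'I_n * 'I_n) : nat :=
  #|[set t in diagram la | (t.1 == s.1) && (s.2 < t.2)]|.

Definition leg (n : nat) (la : intpart n) (s : 'I_n * 'I_n) : nat :=
  #|[set t in diagram la | (t.2 == s.2) && (s.1 < t.1)]|.

Definition conj_parts (s : seq nat) : seq nat :=
  mkseq (fun j => count (fun r => j < r) s) (head 0 s).

Lemma conj_parts_partition (n : nat) (la : intpart n) :
  is_partition n (conj_parts la).
Proof.
have le_head r : r \in (la : seq nat) -> r <= head 0 la.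
  have := intpart_sorted la; case: (la : seq nat) => //= a s.
  rewrite path_sortedE; last by move=> x y z /= xy yz; apply: leq_trans yz xy.
  by move=> /andP[/allP sa _]; rewrite inE => /orP[/eqP->//|/sa].
apply/and3P; split.
- apply: (homo_sorted (e := leq)) (iota_sorted _ _) => i j ij /=.
  by apply: sub_count => r /=; apply: leq_ltn_trans.
- apply/mapP => -[j]; rewrite mem_iota add0n /= => jh /esym/eqP.
  apply/negP; rewrite -lt0n -has_count; move: jh.
  by case: (la : seq nat) => //= a s ->.
- apply/eqP; rewrite -[RHS](intpart_sum la) sumnE big_map.
  have -> : iota 0 (head 0 la) = index_iota 0 (head 0 la).
    by rewrite /index_iota subn0.
  under eq_bigr do rewrite -sum1_count big_mkcond.
  rewrite exchange_big sumnE /=; apply: eq_big_seq => r /le_head rh.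
  rewrite (big_cat_nat (n := r)) //=.
  rewrite [X in _ + X]big_nat [X in _ + X]big1 ?addn0; last first.
    by move=> j /andP[rj _]; rewrite ltnNge rj.
  rewrite big_nat (eq_bigr (fun=> 1)) => [|j /andP[_ ->]//].
  by rewrite -big_nat sum_nat_const_nat muln1 subn0.
Qed.

Definition conj_intpart (n : nat) (la : intpart n) : intpart n :=
  IntPart (conj_parts_partition la).

(* n(lambda); the index i is 0-based, hence the weight i rather than i - 1. *)
Definition nstat (s : seq nat) : nat := \sum_(i < size s) i * nth 0 s i.

Local Open Scope ring_scope.

Definition jack (R : realType) (alpha : R) (n : nat) (la : intpart n) : R :=
  alpha ^+ n * n`!%:R /
  \prod_(s in diagram la)
    ((alpha * (arm la s)%:R + (leg la s)%:R + 1) *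
     (alpha * (arm la s)%:R + (leg la s)%:R + alpha)).

Definition jack_prob (R : realType) (alpha : R) (n : nat)
    (E : pred (intpart n)) : R :=
  \sum_(la : intpart n | E la) jack alpha la.

Definition W (R : realType) (alpha : R) (n : nat) (la : intpart n) : R :=
  (alpha * (nstat (conj_intpart la))%:R - (nstat la)%:R) /
  Num.sqrt (alpha * 'C(n, 2)%:R).

Definition gauss_cdf (R : realType) (x0 : R) : R :=
  (Num.sqrt (2 * pi))^-1 *
  Rintegral lebesgue_measure `]-oo, x0]%classic
    (fun x : R => expR (- (x ^+ 2) / 2)).

(* Main.v *)
From HB Require Import structures.
Require Import Defs.
From mathcomp Require Import all_boot all_order all_algebra.
From mathcomp Require Import all_classical all_reals all_analysis.
From mathcomp Require Import ring lra zify.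

(** The content [alpha * j - i] of a box, summed over [la], gives [alpha *
    n(la') - n(la)], the numerator of [W]. Jack measure is the law at time [n]
    of Kerov's growth process, which adds a box in row [i] with the
    probability [up_prob]; the contents of the successive boxes are martingale
    differences with the deterministic conditional variances [alpha * k].
    These facts, and a formula for the fourth conditional moment, are Lagrange
    interpolation identities in the contents of the rows. The normal
    approximation follows by Lindeberg's method: the contribution of the boxes
    not yet added is replaced by a Gaussian of the same variance, to which a
    further variance of order [n^(3/2)] is added to keep the test functions
    smooth. The errors of the steps add up to [O(n^(-1/4))], and so does the
    cost of the additional variance. *)

Set Implicit Arguments.
Unset Strict Implicit.
Unset Printing Implicit Defensive.

Import Order.TTheory GRing.Theory Num.Theory.
Import numFieldNormedType.Exports.
Local Open Scope ring_scope.

(** * Moments of divided-difference weights *)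

(** As the conditional variances are deterministic, the Gaussian that stands for the missing boxes
    has a fixed variance, and only third absolute moments need estimating. A step after which the
    Gaussian has variance [v] costs about [E|c|^3 / v^(3/2)], where [E|c|^3] is of order at most
    [n^(3/2)]; without additional variance the last steps, where [v] is close to 0, would be out of
    control. With additional variance of order [n * L] and [m] boxes still to come, [v] is at least
    of order [n * (L + m)], and the costs add up to order [L^(-1/2)]. The smoothing then has width
    of order [sqrt (n * L)] against a standard deviation of order [n], and costs [sqrt (L / n)]. The
    two balance at [L = sqrt n], whence the exponents 3/2 and -1/4. The growth process is reached by
    reversibility: removal probabilities that sum to one are brought in, so that the hook products
    only have to satisfy a detailed balance, one box at a time. *)

Section Moments.
Variable R : realFieldType.
Implicit Types (x y : nat -> R) (n m : nat).

(* The residue at [x i] of the quotient of [\prod_(j < n) (z - y j)] by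
   [\prod_(j < n.+1) (z - x j)]. *)
Definition dd_weight x y n i : R :=
  \prod_(j < n) (x i - y j) / \prod_(j < n.+1 | val j != i) (x i - x j).

Definition dd_moment x y n m : R :=
  \sum_(i < n.+1) dd_weight x y n i * x i ^+ m.

Lemma dd_weight_recr x y n i : (i <= n)%N ->
  dd_weight x y n.+1 i = dd_weight x y n i * (x i - y n) / (x i - x n.+1).
Proof.
move=> le_in; rewrite /dd_weight big_ord_recr /=.
rewrite [\prod_(j < n.+2 | _) _]big_mkcond big_ord_recr -big_mkcond /=.
have -> : n.+1 != i by rewrite eq_sym neq_ltn ltnS le_in.
by rewrite invfM; ring.
Qed.

(** Multiplying the weight of [x i] by [x i - x n.+1] cancels its pole at [x n.+1], which leaves
    [dd_weight x y n i * (x i - y n)] and removes the term [i = n.+1]. *)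
Lemma dd_moment_recr x y n m :
    (forall i, (i <= n)%N -> x i != x n.+1) ->
  dd_moment x y n.+1 m.+1 = x n.+1 * dd_moment x y n.+1 m
    + dd_moment x y n m.+1 - y n * dd_moment x y n m.
Proof.
move=> xn; rewrite /dd_moment.
rewrite !(big_ord_recr n.+1) /= mulrDr.
rewrite exprS mulrCA -[RHS]addrA addrAC; congr (_ + _).
rewrite !mulr_sumr -sumrB -big_split; apply: eq_bigr => i _ /=.
have xi : x i - x n.+1 != 0 by rewrite subr_eq0 xn // -ltnS.
by rewrite dd_weight_recr -1?ltnS // exprS; field.
Qed.

(** Lagrange interpolation: the monic polynomial [Q] of degree [n] and the combination of the [L i]
    with these weights agree at the [n.+1] nodes, hence coincide; the claim compares their
    coefficients of degree [n]. *)
Lemma dd_moment0 x y n :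
    (forall i j, (i < j <= n)%N -> x i != x j) ->
  dd_moment x y n 0 = 1.
Proof.
move=> xI; rewrite /dd_moment; under eq_bigr do rewrite expr0 mulr1.
have xI' (i j : 'I_n.+1) : j != i -> x i != x j.
  rewrite neq_ltn => /orP[ji|ij].
    by rewrite eq_sym xI // ji -ltnS ltn_ord.
  by rewrite xI // ij -ltnS ltn_ord.
pose L (i : 'I_n.+1) : {poly R} := \prod_(j < n.+1 | j != i) ('X - (x j)%:P).
have [sL mL] : (forall i, size (L i) = n.+1) /\ forall i, L i \is monic.
  split=> i; (have -> : L i = \prod_(j <- enum (predC1 i)) ('X - (x j)%:P)
    by rewrite big_enum); rewrite ?monic_prod_XsubC // size_prod_XsubC.
  by rewrite -cardE cardC1 card_ord.
pose Q : {poly R} := \prod_(j < n) ('X - (y j)%:P).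
have [sQ mQ] : size Q = n.+1 /\ Q \is monic.
  rewrite /Q monic_prod_XsubC; split=> //.
  by rewrite -big_enum size_prod_XsubC -cardE card_ord.
pose w (i : 'I_n.+1) := dd_weight x y n i.
pose D := Q - \sum_(i < n.+1) w i *: L i.
have sD : (size D <= n.+1)%N.
  rewrite (leq_trans (size_polyD _ _)) // geq_max sQ leqnn size_polyN.
  apply: (leq_trans (size_sum _ _ _)); apply/bigmax_leqP => i _.
  by rewrite (leq_trans (size_scale_leq _ _)) ?sL.
have D0 : D = 0.
  apply/eqP/negPn/negP => D_neq0.
  suff : (size [seq x (val i) | i : 'I_n.+1] < size D)%N.
    by rewrite size_map -cardT card_ord ltnNge sD.
  apply: max_poly_roots => //; last first.
    rewrite map_inj_uniq ?enum_uniq // => i j xij.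
    by apply/eqP/negPn/negP => /xI'; rewrite xij eqxx.
  apply/allP => _ /mapP[i _ ->]; rewrite rootE /D !hornerE horner_sum.
  rewrite (bigD1 i) //= [\sum_(_ < _ | _) _]big1 => [|j ji]; last first.
    rewrite hornerZ horner_prod (bigD1 i) ?(eq_sym i) //=.
    by rewrite hornerXsubC subrr mul0r mulr0.
  rewrite addr0 hornerZ /Q /L !horner_prod.
  have hX (P : pred 'I_n.+1) : \prod_(j < n.+1 | P j) ('X - (x j)%:P).[x i] =
      \prod_(j < n.+1 | P j) (x i - x j).
    by apply: eq_bigr => j _; rewrite hornerXsubC.
  under eq_bigr do rewrite hornerXsubC.
  rewrite hX.
  rewrite /w /dd_weight divfK ?subrr //.
  by apply/prodf_neq0 => j ji; rewrite subr_eq0 xI'.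
have := congr1 (fun p : {poly R} => p`_n) D0.
rewrite /D coefB coef_sum coef0.
have lc (p : {poly R}) : size p = n.+1 -> p \is monic -> p`_n = 1.
  by move=> sp /monicP; rewrite lead_coefE sp.
rewrite lc // => /eqP; rewrite subr_eq0 => /eqP ->.
by apply: eq_bigr => i _; rewrite coefZ lc // mulr1.
Qed.

Definition psum x y n k : R :=
  \sum_(i < n.+1) x i ^+ k - \sum_(j < n) y j ^+ k.

Lemma psum_recr x y n k :
  psum x y n.+1 k = psum x y n k + x n.+1 ^+ k - y n ^+ k.
Proof.
rewrite /psum [\sum_(i < n.+2) _]big_ord_recr [\sum_(j < n.+1) y j ^+ k]big_ord_recr.
by rewrite /=; ring.
Qed.

(* The moments are the complete homogeneous symmetric functions of the
   difference of the alphabets [x] and [y], [psum] being its power sums. *)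
Lemma dd_momentE x y n :
    (forall i j, (i < j <= n)%N -> x i != x j) ->
  [/\ dd_moment x y n 1 = psum x y n 1,
      dd_moment x y n 2 = (psum x y n 1 ^+ 2 + psum x y n 2) / 2,
      dd_moment x y n 3 = (psum x y n 1 ^+ 3
        + 3 * psum x y n 1 * psum x y n 2 + 2 * psum x y n 3) / 6 &
      dd_moment x y n 4 = (psum x y n 1 ^+ 4
        + 6 * psum x y n 1 ^+ 2 * psum x y n 2 + 3 * psum x y n 2 ^+ 2
        + 8 * psum x y n 1 * psum x y n 3 + 6 * psum x y n 4) / 24].
Proof.
elim: n => [|n IH] xI.
  rewrite /dd_moment /psum !big_ord_recl !big_ord0 /= /dd_weight big_ord0.
  rewrite big_pred0 => [|j]; last by rewrite (ord1 j).
  by split; field.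
have xn i : (i <= n)%N -> x i != x n.+1 by move=> ?; rewrite xI // ltnS leqnn andbT.
have xI' i j : (i < j <= n)%N -> x i != x j.
  by move=> /andP[ij jn]; rewrite xI // ij ltnW.
have [m1 m2 m3 m4] := IH xI'.
have M1 : dd_moment x y n.+1 1 = psum x y n.+1 1.
  by rewrite dd_moment_recr // !dd_moment0 // m1 psum_recr; ring.
have M2 : dd_moment x y n.+1 2 = (psum x y n.+1 1 ^+ 2 + psum x y n.+1 2) / 2.
  by rewrite dd_moment_recr // M1 m1 m2 !psum_recr; field.
have M3 : dd_moment x y n.+1 3 = (psum x y n.+1 1 ^+ 3
    + 3 * psum x y n.+1 1 * psum x y n.+1 2 + 2 * psum x y n.+1 3) / 6.
  by rewrite dd_moment_recr // M2 m2 m3 !psum_recr; field.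
split=> //.
by rewrite dd_moment_recr // M3 m3 m4 !psum_recr; field.
Qed.
End Moments.

(** * Growth and decay probabilities *)

Section Growth.
Variables (R : realFieldType) (alpha : R).
Hypothesis alpha_gt0 : 0 < alpha.
Implicit Types (f : nat -> nat) (n i j k : nat).

Definition nonincr f := forall i j, (i <= j)%N -> (f j <= f i)%N.

(* The content of the box that would extend row [i]; rows count from [0]. *)
Definition content f i : R := alpha * (f i)%:R - i%:R.

Lemma contentB_ge f i j : nonincr f -> (i <= j)%N ->
  j%:R - i%:R <= content f i - content f j.
Proof.
move=> fd ij; rewrite /content.
have : (f j)%:R <= (f i)%:R :> R by rewrite ler_nat fd.
move/(ler_wpM2l (ltW alpha_gt0)); lra.
Qed.

Lemma contentB_ge1 f i j : nonincr f -> (i < j)%N -> 1 <= content f i - content f j.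
Proof.
move=> fd ij; apply: le_trans (contentB_ge fd (ltnW ij)).
by rewrite -natrB ?(ltnW ij) // ler1n subn_gt0.
Qed.

Lemma content_inj f i j : nonincr f -> i != j -> content f i - content f j != 0.
Proof.
move=> fd; rewrite neq_ltn => /orP[] ij; have h := contentB_ge1 fd ij.
  by rewrite gt_eqF //; lra.
by rewrite lt_eqF //; lra.
Qed.

(* For a partition of [n], whose row [n] is thus empty. The factor [j = i - 1]
   vanishes when row [i] cannot be extended. *)
Definition up_prob n f i : R := dd_weight (content f) (fun j => content f j - 1) n i.

(** Pairing each zero [content f j - 1] with the pole [content f j] exhibits factors [(z + 1) / z],
    nonnegative because contents of distinct rows differ by at least 1. There is one zero fewer than
    poles up to [n], so the factor of [j = n] is inserted and divided out in front. *)
Lemma up_prodE n f i : nonincr f -> (i <= n)%N ->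
  up_prob n f i = (content f i - content f n + 1)^-1 *
    \prod_(j < n.+1 | val j != i)
      ((content f i - content f j + 1) / (content f i - content f j)).
Proof.
move=> fd le_in; rewrite /up_prob /dd_weight big_split /= prodfV mulrA.
congr (_ / _); set z := _ - _ + 1.
have z0 : z != 0.
  rewrite gt_eqF // /z; have := contentB_ge fd le_in.
  have : i%:R <= n%:R :> R by rewrite ler_nat.
  lra.
apply: (mulfI z0); rewrite mulVKf //.
have -> : \prod_(j < n) (content f i - (content f j - 1)) =
          \prod_(j < n) (content f i - content f j + 1).
  by apply: eq_bigr => j _; ring.
transitivity (\prod_(j < n.+1) (content f i - content f j + 1)).
  by rewrite big_ord_recr mulrC.
have lt_in : (i < n.+1)%N by [].
by rewrite (bigD1 (Ordinal lt_in)) //= subrr add0r mul1r.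
Qed.

Lemma up_ge0 n f i : nonincr f -> (i <= n)%N -> 0 <= up_prob n f i.
Proof.
move=> fd le_in; rewrite up_prodE // mulr_ge0 //.
  rewrite invr_ge0; have := contentB_ge fd le_in.
  have : i%:R <= n%:R :> R by rewrite ler_nat.
  lra.
apply: prodr_ge0 => j; rewrite neq_ltn => /orP[] ij; have h := contentB_ge1 fd ij.
  by rewrite mulr_le0 // ?invr_le0; lra.
by rewrite mulr_ge0 // ?invr_ge0; lra.
Qed.

Lemma up_eq0 n f i : (i < n)%N -> f i.+1 = f i -> up_prob n f i.+1 = 0.
Proof.
move=> lt_in fi; rewrite /up_prob /dd_weight (bigD1 (Ordinal lt_in)) //= /content fi.
rewrite [X in X * _ / _](_ : _ = 0) ?mul0r //.
by rewrite -[i.+1%:R]natr1; ring.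
Qed.

Lemma sum_natr n : \sum_(i < n) i%:R = n%:R * (n%:R - 1) / 2 :> R.
Proof.
elim: n => [|n IH]; first by rewrite big_ord0; field.
by rewrite big_ord_recr /= IH -[n.+1%:R]natr1; field.
Qed.

Let sum1n n : \sum_(i < n) 1 = n%:R :> R.
Proof. by rewrite sumr_const card_ord. Qed.

Lemma sum_content n f : \sum_(i < n) content f i =
  alpha * (\sum_(i < n) f i)%:R - n%:R * (n%:R - 1) / 2.
Proof. by rewrite sumrB -mulr_sumr sum_natr natr_sum. Qed.

Definition up_p4 n f : R :=
  \sum_(i < n.+1) content f i ^+ 4 - \sum_(j < n) (content f j - 1) ^+ 4.

Lemma up_moments n f : nonincr f -> f n = 0%N -> (\sum_(i < n) f i)%N = n ->
  [/\ \sum_(i < n.+1) up_prob n f i = 1,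
      \sum_(i < n.+1) up_prob n f i * content f i = 0,
      \sum_(i < n.+1) up_prob n f i * content f i ^+ 2 = alpha * n%:R &
      \sum_(i < n.+1) up_prob n f i * content f i ^+ 4 =
        (alpha * n%:R) ^+ 2 / 2 + up_p4 n f / 4].
Proof.
move=> fd fn fs.
have xI i j : (i < j <= n)%N -> content f i != content f j.
  by move=> /andP[ij _]; rewrite -subr_eq0 content_inj // neq_ltn ij.
pose y j := content f j - 1.
have [m1 m2 _ m4] := dd_momentE y xI.
have p1 : psum (content f) y n 1 = 0.
  rewrite /psum /y; under eq_bigr do rewrite expr1.
  have -> : \sum_(j < n) (content f j - 1) ^+ 1 = \sum_(j < n) content f j - n%:R.
    rewrite -(sum1n n) -sumrB.
    by apply: eq_bigr => j _; rewrite expr1.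
  rewrite big_ord_recr /=.
  by rewrite [content f n]/content fn; ring.
have p2 : psum (content f) y n 2 = 2 * alpha * n%:R.
  rewrite /psum /y big_ord_recr /=.
  have -> : \sum_(j < n) (content f j - 1) ^+ 2 =
      \sum_(j < n) content f j ^+ 2 - 2 * \sum_(j < n) content f j + n%:R.
    rewrite mulr_sumr -(sum1n n) -sumrB -big_split /=.
    by apply: eq_bigr => j _; ring.
  by rewrite sum_content fs [content f n]/content fn; field.
split.
- by rewrite -(dd_moment0 y xI); apply: eq_bigr => i _; rewrite mulr1.
- by rewrite -[RHS]p1 -m1; apply: eq_bigr => i _; rewrite expr1.
- by rewrite -[LHS]/(dd_moment (content f) y n 2) m2 p1 p2; field.
- rewrite -[LHS]/(dd_moment (content f) y n 4) m4 p1 p2.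
  by rewrite -[up_p4 n f]/(psum (content f) y n 4); field.
Qed.

(* For a partition of [n + 1]: the probability of removing a box from row [i],
   which vanishes when row [i] cannot be shortened. *)
Definition down_prob n f i : R :=
  (content f i + n%:R) / (alpha * n.+1%:R) * \prod_(j < n.+1 | val j != i)
    ((content f i - content f j - 1) / (content f i - content f j)).

Lemma down_eq0 n f i : (i <= n)%N -> f n.+1 = 0%N -> f i.+1 = f i ->
  down_prob n f i = 0.
Proof.
move=> le_in fn fi; rewrite /down_prob; move: le_in; rewrite leq_eqVlt.
move=> /orP[/eqP i_n|lt_in].
  by rewrite /content -fi i_n fn mulr0 sub0r addNr !mul0r.
have lt_in' : (i.+1 < n.+1)%N by [].
rewrite [\prod_(j < _ | _) _](bigD1 (Ordinal lt_in')) /=; last first.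
  by rewrite neq_ltn ltnSn orbT.
have -> : content f i - content f i.+1 - 1 = 0.
  by rewrite /content fi -[i.+1%:R]natr1; ring.
by rewrite !mul0r mulr0.
Qed.

(** The factor [j = i] missing from the product would be -1. Restoring it gives the weights with
    zeros [content f j + 1] for [j < n], times a quadratic in [c = content f i]: the prefactor
    [c + n] and the factor [c - content f n - 1] of [j = n]. Moments 0 to 2 then suffice. *)
Lemma sum_down n f : nonincr f -> (\sum_(i < n.+1) f i)%N = n.+1 ->
  \sum_(i < n.+1) down_prob n f i = 1.
Proof.
move=> fd fs.
have xI i j : (i < j <= n)%N -> content f i != content f j.
  by move=> /andP[ij _]; rewrite -subr_eq0 content_inj // neq_ltn ij.
pose y j := content f j + 1.
have [m1 m2 _ _] := dd_momentE y xI.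
have p1 : psum (content f) y n 1 = content f n - n%:R.
  rewrite /psum /y; under eq_bigr do rewrite expr1.
  have -> : \sum_(j < n) (content f j + 1) ^+ 1 = \sum_(j < n) content f j + n%:R.
    rewrite -(sum1n n) -big_split.
    by apply: eq_bigr => j _; rewrite expr1.
  by rewrite big_ord_recr /=; ring.
have a0 : alpha != 0 by rewrite gt_eqF.
have n0 : 1 + n%:R != 0 :> R by rewrite nat1r pnatr_eq0.
have sf : \sum_(j < n) content f j =
    alpha * n.+1%:R - n.+1%:R * n%:R / 2 - content f n.
  apply: (addIr (content f n)); rewrite subrK -[LHS]/(_ + _).
  have := sum_content n.+1 f; rewrite big_ord_recr /= fs => ->.
  by rewrite -[n.+1%:R]natr1; field.
have p2 : psum (content f) y n 2 =
    content f n ^+ 2 - 2 * (\sum_(j < n) content f j) - n%:R.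
  rewrite /psum /y big_ord_recr /=.
  have -> : \sum_(j < n) (content f j + 1) ^+ 2 =
      \sum_(j < n) content f j ^+ 2 + 2 * \sum_(j < n) content f j + n%:R.
    rewrite mulr_sumr -(sum1n n) -!big_split /=.
    by apply: eq_bigr => j _; ring.
  by ring.
pose D m := dd_moment (content f) y n m.
have -> : \sum_(i < n.+1) down_prob n f i = - (alpha * n.+1%:R)^-1 *
   (D 2 + (n%:R - content f n - 1) * D 1%N - (n%:R * (content f n + 1)) * D 0%N).
  rewrite /D /dd_moment !mulr_sumr -big_split -sumrB mulr_sumr /=.
  apply: eq_bigr => i _.
  rewrite /down_prob /dd_weight big_split /= prodfV !mulrA.
  set V := (\prod_(j < n.+1 | _) _)^-1.
  have -> : \prod_(j < n.+1 | val j != i) (content f i - content f j - 1) =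
      - \prod_(j < n.+1) (content f i - content f j - 1).
    by rewrite [in RHS](bigD1 i) //= subrr sub0r mulN1r opprK.
  rewrite big_ord_recr /=.
  have -> : \prod_(j < n) (content f i - y j) = 
            \prod_(j < n) (content f i - content f j - 1).
    by apply: eq_bigr => j _; rewrite /y; ring.
  by field; rewrite n0 a0.
rewrite {}/D m2 m1 (dd_moment0 _ xI) p1 p2 sf -[n.+1%:R]natr1.
by field; rewrite addrC n0 a0.
Qed.
End Growth.

(** * Hook products *)

Section Hooks.
Variables (R : realFieldType) (alpha : R).
Hypothesis alpha_gt0 : 0 < alpha.
Implicit Types (f : nat -> nat) (n i j k N : nat).

Definition colh N f j := (\sum_(k < N) (j < f k))%N.

Definition hook_factor (a l : R) : R := (alpha * a + l + 1) * (alpha * a + l + alpha).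

Definition hook_row N f k : R := \prod_(0 <= j < f k)
  hook_factor ((f k)%:R - j%:R - 1) ((colh N f j)%:R - k%:R - 1).

Definition hook N f : R := \prod_(k < N) hook_row N f k.

Definition addrow f i := fun k => (f k + (k == i))%N.

Lemma hook_factor_gt0 a l : 0 <= a -> 0 <= l -> 0 < hook_factor a l.
Proof.
move=> a0 l0; have : 0 <= alpha * a by rewrite mulr_ge0 // ltW.
by have p := alpha_gt0; move=> h; rewrite mulr_gt0 //; lra.
Qed.

Lemma colhE N f j K : nonincr f -> (K <= N)%N ->
    (forall k, (k < K)%N -> (j < f k)%N) -> (f K <= j)%N -> colh N f j = K.
Proof.
move=> fd KN lt_j le_j; rewrite /colh.
rewrite (eq_bigr (fun k : 'I_N => (k < K)%N : nat)) => [|k _]; last first.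
  congr nat_of_bool; have [kK|Kk] := ltnP k K; first exact: lt_j.
  by apply/negbTE; rewrite -leqNgt (leq_trans (fd _ _ Kk)).
by rewrite -big_mkcond /= (big_ord_narrow KN) sum1_card card_ord.
Qed.

Lemma colh_addrow N f i j : (i < N)%N ->
  colh N (addrow f i) j = (colh N f j + (j == f i))%N.
Proof.
move=> iN; rewrite /colh (bigD1 (Ordinal iN)) //=.
rewrite [in RHS](bigD1 (Ordinal iN)) //= /addrow eqxx addnAC; congr (_ + _)%N.
  by rewrite addn1 ltnS leq_eqVlt; case: ltngtP.
by apply: eq_bigr => k /negbTE ki; rewrite -val_eqE /= in ki; rewrite ki addn0.
Qed.

Definition addable f i := (i == 0)%N || (f i < f i.-1)%N.

Lemma addable_lt f i k : nonincr f -> addable f i -> (k < i)%N -> (f i < f k)%N.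
Proof.
move=> fd; rewrite /addable; case: i => [|i] /= lt_f; first by rewrite ltn0.
by rewrite ltnS => /fd; apply: leq_trans.
Qed.

Lemma colh_addable N f i : nonincr f -> addable f i -> (i < N)%N ->
  colh N f (f i) = i.
Proof.
move=> fd ai iN; apply: colhE => //; first exact: ltnW.
by move=> k; exact: addable_lt.
Qed.

(** A new box in row [i] lengthens every arm of that row by one. On the columns [f t.+1 <= j < f t]
    the leg is constantly [t - i], so lengthening the arm shifts the index of the product by one and
    only the end factors of the block survive. The induction appends these blocks from the tallest
    columns on. *)
Let hook_row_telescope N f i (z := fun k => content alpha f i - content alpha f k) :
    nonincr f -> (i < N)%N -> f N = 0%N ->
  forall d, (d <= N - i)%N ->
  \prod_(0 <= j < f (N - d)%N)
      hook_factor ((f i)%:R - j%:R) ((colh N f j)%:R - i%:R - 1)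
  = \prod_(0 <= j < f (N - d)%N)
      hook_factor ((f i)%:R - j%:R - 1) ((colh N f j)%:R - i%:R - 1) *
    \prod_(N - d <= k < N) (z k.+1 * (z k.+1 + alpha - 1) /
      ((z k + 1) * (z k + alpha))).
Proof.
move=> fd iN fN; elim=> [|d IH] dN.
  by rewrite subn0 fN !big_geq // mulr1.
have {}IH := IH (ltnW dN).
set t := (N - d.+1)%N; have tS : (N - d)%N = t.+1 by rewrite /t; lia.
have it : (i <= t)%N by rewrite /t; lia.
have tN : (t < N)%N by rewrite /t; lia.
rewrite tS in IH; have ft : (f t.+1 <= f t)%N by exact: fd.
rewrite !(@big_cat_nat _ _ _ (f t.+1) 0 (f t)) //= IH -!mulrA; congr (_ * _).
rewrite [\prod_(t <= k < N) _]big_ltn // mulrA [RHS]mulrC; congr (_ * _).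
have colt j : (f t.+1 <= j < f t)%N -> (colh N f j)%:R - i%:R - 1 = t%:R - i%:R :> R.
  move=> /andP[lj uj]; rewrite (@colhE _ _ _ t.+1) // -?natr1; first by ring.
  by move=> k kt; apply: leq_trans uj (fd _ _ _).
pose h j := hook_factor ((f i)%:R - j%:R) (t%:R - i%:R).
have -> : \prod_(f t.+1 <= j < f t)
    hook_factor ((f i)%:R - j%:R) ((colh N f j)%:R - i%:R - 1) =
    \prod_(f t.+1 <= j < f t) h j.
  by apply: eq_big_nat => j /colt ->.
have -> : \prod_(f t.+1 <= j < f t)
    hook_factor ((f i)%:R - j%:R - 1) ((colh N f j)%:R - i%:R - 1) =
    \prod_(f t.+1 <= j < f t) h j.+1.
  apply: eq_big_nat => j /colt ->; rewrite /h; congr hook_factor.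
  by rewrite -natr1; ring.
have le_it : i%:R <= t%:R :> R by rewrite ler_nat.
have h0 j : (j <= f t)%N -> h j != 0.
  move=> jt; rewrite gt_eqF // hook_factor_gt0 ?subr_ge0 // ler_nat.
  by rewrite (leq_trans jt) // fd.
have E : \prod_(f t.+1 <= j < f t) h j * h (f t) =
    \prod_(f t.+1 <= j < f t) h j.+1 * h (f t.+1).
  by rewrite -big_nat_recr // big_nat_recl // mulrC.
have -> : z t.+1 * (z t.+1 + alpha - 1) = h (f t.+1).
  by rewrite /h /hook_factor /z /content -[t.+1%:R]natr1; ring.
have -> : (z t + 1) * (z t + alpha) = h (f t).
  by rewrite /h /hook_factor /z /content; ring.
by rewrite mulrA -E mulfK // h0.
Qed.

(** For [k < i], the change of the hook of row [k] above the new box, [z] being the content of row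
    [i] minus that of row [k]; rows below [i] yield the same expression after telescoping. *)
Definition hook_ratio z : R := z * (z + alpha - 1) / ((z + 1) * (z + alpha)).

(* Above row [i], only the hooks of the column of the new box change; the
   product over row [i] telescopes between consecutive column heights. *)
Lemma hook_addrow N f i : nonincr f -> addable f i -> (i < N)%N -> f N = 0%N ->
  hook N (addrow f i) = hook N f *
   ((content alpha f i + N%:R) * (content alpha f i + N%:R + alpha - 1)) *
   \prod_(k < N | val k != i) hook_ratio (content alpha f i - content alpha f k).
Proof.
move=> fd ai iN fN; pose z k := content alpha f i - content alpha f k.
have rowlt k : (k < i)%N -> hook_row N (addrow f i) k =
    hook_row N f k * hook_ratio (z k).
  move=> ki; rewrite /hook_row /addrow (ltn_eqF ki) addn0.
  have fk := addable_lt fd ai ki.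
  rewrite !(@big_cat_nat _ _ _ (f i) 0 (f k)) ?(ltnW fk) //=.
  rewrite (big_ltn fk) [X in _ = _ * X * _](big_ltn fk).
  have E (a b : nat) : ((b <= f i) || (f i < a))%N ->
    \prod_(a <= j < b) hook_factor ((f k)%:R - j%:R - 1)
      ((colh N (addrow f i) j)%:R - k%:R - 1) =
    \prod_(a <= j < b) hook_factor ((f k)%:R - j%:R - 1) ((colh N f j)%:R - k%:R - 1).
    move=> ab; apply: eq_big_nat => j jab; rewrite colh_addrow //.
    by rewrite (_ : (j == f i) = false) ?addn0 //; apply/eqP; lia.
  rewrite -/(addrow f i) !E ?leqnn ?orbT // colh_addrow // eqxx colh_addable //.
  have c1 : i%:R - k%:R >= 1 :> R.
    by rewrite -natrB ?(ltnW ki) // ler1n subn_gt0.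
  have c2 : 0 <= alpha * ((f k)%:R - (f i)%:R - 1).
    rewrite mulr_ge0 ?(ltW alpha_gt0) // subr_ge0 -natrB ?(ltnW fk) //.
    by rewrite ler1n subn_gt0.
  rewrite -[RHS]mulrA; congr (_ * _); rewrite [RHS]mulrAC; congr (_ * _).
  rewrite /hook_factor /hook_ratio /z /content natrD /=; field.
  have a0 := alpha_gt0.
  by apply/andP; split; apply/eqP => h; move: c1 c2; lra.
have rowgt k : (i < k)%N -> hook_row N (addrow f i) k = hook_row N f k.
  move=> ik; rewrite /hook_row /addrow (gtn_eqF ik) addn0.
  apply: eq_big_nat => j /andP[_ jk]; rewrite -/(addrow f i) colh_addrow //.
  by rewrite (_ : (j == f i) = false) ?addn0 //; have := fd _ _ (ltnW ik); lia.
have rowi : hook_row N (addrow f i) i = hook_row N f i *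
    ((content alpha f i + N%:R) * (content alpha f i + N%:R + alpha - 1)) *
     \prod_(i.+1 <= k < N) hook_ratio (z k).
  rewrite /hook_row {1 2}/addrow eqxx addn1 big_nat_recr //=.
  rewrite colh_addrow // eqxx colh_addable // addn1.
  have -> : hook_factor ((f i).+1%:R - (f i)%:R - 1) (i.+1%:R - i%:R - 1) = alpha.
    by rewrite /hook_factor -!natr1; ring.
  have -> : \prod_(0 <= j < f i) hook_factor ((f i).+1%:R - j%:R - 1)
      ((colh N (addrow f i) j)%:R - i%:R - 1) =
    \prod_(0 <= j < f i) hook_factor ((f i)%:R - j%:R) ((colh N f j)%:R - i%:R - 1).
    apply: eq_big_nat => j /andP[_ ji]; rewrite colh_addrow // (ltn_eqF ji) addn0.
    by congr hook_factor; rewrite -natr1; ring.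
  have := hook_row_telescope fd iN fN (leqnn _).
  rewrite subKn ?(ltnW iN) // => ->.
  (* Numerators carry the index [k.+1], denominators [k]. Realigning them leaves [u N], the factor
     in the statement, and [v i = alpha], which cancels the factor of the new box. *)
  pose u k := z k * (z k + alpha - 1); pose v k := (z k + 1) * (z k + alpha).
  have -> : \prod_(i <= k < N) (z k.+1 * (z k.+1 + alpha - 1) /
      ((z k + 1) * (z k + alpha))) =
      (\prod_(i.+1 <= k < N) u k * u N) / \prod_(i <= k < N) v k.
    rewrite -(big_nat_recr N i.+1 u) // big_add1 -prodfV -big_split.
    by apply: eq_bigr.
  have -> : \prod_(i.+1 <= k < N) hook_ratio (z k) =
      \prod_(i.+1 <= k < N) u k / \prod_(i.+1 <= k < N) v k.
    by rewrite -prodfV -big_split.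
  have zN : z N = content alpha f i + N%:R.
    by rewrite /z [content alpha f N]/content fN; ring.
  have vi : v i = alpha by rewrite /v /z subrr; ring.
  rewrite (big_ltn iN) vi [u N]/u zN invfM.
  set P := \prod_(0 <= k < _) _; set A := \prod_(i.+1 <= k < N) _.
  set B := (\prod_(i.+1 <= k < N) _)^-1.
  by field; rewrite gt_eqF.
rewrite /hook [LHS](bigD1 (Ordinal iN)) // [X in _ = X * _ * _](bigD1 (Ordinal iN)) //=.
rewrite rowi; set r := hook_row N f i; set c := (_ + N%:R) * _.
have -> : \prod_(i.+1 <= k < N) hook_ratio (z k) =
    \prod_(k < N | k != Ordinal iN) if (k < i)%N then 1 else hook_ratio (z k).
  rewrite (@big_nat_widenl _ _ _ _ 0%N) // big_mkord big_mkcond [RHS]big_mkcond.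
  by apply: eq_bigr => k _; rewrite -val_eqE /=; case: ltngtP.
have -> : \prod_(k < N | k != Ordinal iN) hook_row N (addrow f i) k =
    \prod_(k < N | k != Ordinal iN)
      (hook_row N f k * if (k < i)%N then hook_ratio (z k) else 1).
  apply: eq_bigr => k; rewrite -val_eqE /=; case: ltngtP => // ki _.
    by rewrite rowlt.
  by rewrite rowgt // mulr1.
rewrite big_split /=.
have -> : \prod_(k < N | val k != i) hook_ratio (z k) =
    \prod_(k < N | k != Ordinal iN) (if (k < i)%N then hook_ratio (z k) else 1) *
    \prod_(k < N | k != Ordinal iN) if (k < i)%N then 1 else hook_ratio (z k).
  rewrite -big_split; apply: eq_bigr => k _ /=.
  by case: ifP => _; rewrite ?mulr1 ?mul1r.
ring.
Qed.
End Hooks.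

(** * Detailed balance between growth and decay *)

Section Balance.
Variables (R : realFieldType) (alpha : R).
Hypothesis alpha_gt0 : 0 < alpha.
Implicit Types (f : nat -> nat) (n i j k N : nat).

Lemma nonincr_addrow f i : nonincr f -> addable f i -> nonincr (addrow f i).
Proof.
move=> fd ai j k jk; rewrite /addrow; have fjk := fd _ _ jk.
case: (eqVneq k i) => [ki|_]; last by rewrite addn0 (leq_trans fjk) ?leq_addr.
case: (eqVneq j i) => [ji|ji]; first by rewrite leq_add2r.
by rewrite addn0 addn1 ki (addable_lt fd ai) // ltn_neqAle ji -ki.
Qed.

Lemma colh_gt N f j k : nonincr f -> (k < N)%N -> (j < f k)%N -> (k < colh N f j)%N.
Proof.
move=> fd kN jk; rewrite /colh -(big_mkord xpredT (fun m => (j < f m)%N : nat)).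
rewrite (@big_cat_nat _ _ _ k.+1) //= (leq_trans _ (leq_addr _ _)) //.
rewrite (eq_big_nat _ _ (F2 := fun=> 1%N)) => [|m /andP[_ mk]].
  by rewrite sum_nat_const_nat subn0 muln1.
by rewrite (leq_trans jk) // fd.
Qed.

Lemma hook_gt0 N f : nonincr f -> 0 < hook alpha N f.
Proof.
move=> fd; apply: prodr_gt0 => k _; rewrite /hook_row big_nat.
apply: prodr_gt0 => j /andP[_ jk]; apply: hook_factor_gt0 => //.
  by rewrite -natrB ?(ltnW jk) // subr_ge0 ler1n subn_gt0.
have := colh_gt fd (ltn_ord k) jk.
by move=> h; rewrite -natrB ?(ltnW h) // subr_ge0 ler1n subn_gt0.
Qed.

Lemma hook_widen N f : f N = 0%N -> hook alpha N.+1 f = hook alpha N f.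
Proof.
move=> fN; rewrite /hook big_ord_recr /= [X in _ * X]/hook_row fN big_geq //.
rewrite mulr1; apply: eq_bigr => k _; apply: eq_big_nat => j _.
by rewrite /colh big_ord_recr /= fN addn0.
Qed.

Definition jack_weight n f : R := alpha ^+ n * n`!%:R / hook alpha n f.

Lemma jack_weight_ge0 n f : nonincr f -> 0 <= jack_weight n f.
Proof.
move=> fd; rewrite /jack_weight mulr_ge0 // ?invr_ge0 ?(ltW (hook_gt0 _ fd)) //.
by rewrite mulr_ge0 // exprn_ge0 // ltW.
Qed.

(** The new box raises the content of row [i] by [alpha], so [down_prob] has factors
    [(z + alpha - 1) / (z + alpha)], which are the factors [(z + 1) / z] of [up_prob] times
    [hook_ratio alpha z]. The product of these ratios is the one in [hook_addrow], and the
    prefactors match. *)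
Lemma jack_weight_balance n f i : nonincr f -> f n = 0%N -> (i <= n)%N ->
    addable f i ->
  jack_weight n f * up_prob alpha n f i =
  jack_weight n.+1 (addrow f i) * down_prob alpha n (addrow f i) i.
Proof.
move=> fd fn le_in ai.
have fSn : f n.+1 = 0%N by apply/eqP; rewrite -leqn0 -fn fd.
have a0 := alpha_gt0.
have lt_in : (i < n.+1)%N by [].
rewrite /jack_weight hook_addrow // -(hook_widen fn).
set c := content alpha f i.
have c_ge : n.+1%:R - 1 + c >= 0.
  rewrite /c /content; have : i%:R <= n%:R :> R by rewrite ler_nat.
  have : 0 <= alpha * (f i)%:R by rewrite mulr_ge0 // ltW.
  by rewrite -[n.+1%:R]natr1; lra.
have h0 : hook alpha n.+1 f != 0 by rewrite gt_eqF // hook_gt0.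
rewrite up_prodE // -/c.
have -> : c - content alpha f n + 1 = c + n.+1%:R.
  by rewrite [content _ _ n]/content fn -natr1; ring.
have dk k : content alpha (addrow f i) i - content alpha (addrow f i) k =
    if k == i then 0 else c - content alpha f k + alpha.
  rewrite /content /addrow eqxx; case: eqVneq => [->|ki]; first by rewrite subrr.
  by rewrite addn0 /c /content natrD /=; ring.
rewrite /down_prob.
have -> : content alpha (addrow f i) i + n%:R = c + n.+1%:R + alpha - 1.
  rewrite /content /addrow eqxx /c /content natrD (_ : true%:R = 1) //.
  by rewrite -[n.+1%:R]natr1; ring.
have -> : \prod_(j < n.+1 | val j != i)
    ((content alpha (addrow f i) i - content alpha (addrow f i) j - 1) /
     (content alpha (addrow f i) i - content alpha (addrow f i) j)) =
    \prod_(j < n.+1 | val j != i)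
     ((c - content alpha f j + 1) / (c - content alpha f j)) *
    \prod_(j < n.+1 | val j != i) hook_ratio alpha (c - content alpha f j).
  rewrite -big_split; apply: eq_bigr => j ji /=.
  rewrite dk (negbTE ji) /hook_ratio; set z := c - _.
  have z0 : z != 0 by rewrite content_inj // eq_sym.
  suff [z1 za] : z + 1 != 0 /\ z + alpha != 0 by field; rewrite z0 z1 za.
  move: ji; rewrite neq_ltn /z /c => /orP[] ij; last first.
    by have := contentB_ge1 alpha_gt0 fd ij; split; rewrite gt_eqF //; lra.
  have := addable_lt fd ai ij.
  have : (j : nat)%:R + 1 <= i%:R :> R by rewrite natr1 ler_nat.
  rewrite -(ler_nat R) -natr1 => h1 h2.
  have := ler_wpM2l (ltW alpha_gt0) h2.
  by rewrite /content => h3; split; rewrite lt_eqF //; lra.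
(* The product divides the hook product of the enlarged diagram, which is positive. *)
have r0 : \prod_(j < n.+1 | val j != i) hook_ratio alpha (c - content alpha f j) != 0.
  have := hook_gt0 n.+1 (nonincr_addrow fd ai); rewrite hook_addrow //.
  by apply: contraTneq => ->; rewrite mulr0 ltxx.
move: r0; set A := \prod_(j < _ | _) hook_ratio _ _.
set B := \prod_(j < _ | _) (_ / _) => r0.
rewrite exprS factS natrM.
have n1 : n.+1%:R = 1 + n%:R :> R by rewrite nat1r.
have n0 : 1 + n%:R != 0 :> R by rewrite -n1 pnatr_eq0.
field; rewrite n0 r0 h0 (gt_eqF a0) /=.
by apply/andP; split; rewrite gt_eqF //; move: c_ge; rewrite n1; lra.
Qed.
End Balance.

(** * Partitions as sequences of rows *)

Section Rows.
Implicit Types (f : nat -> nat) (n i j k N : nat).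

(** As total functions, partitions of all sizes share one type, and a box in a new row is added by
    the same formula as in an old one. *)
Definition rows n (la : intpart n) : nat -> nat := nth 0%N la.

Lemma rows_nonincr n (la : intpart n) : nonincr (rows la).
Proof.
move=> i j ij; rewrite /rows; case: (ltnP j (size la)) => [jn|nj].
  have geT : transitive geq by move=> x y z /= xy yz; apply: leq_trans yz xy.
  have := sorted_leq_nth geT (fun x => leqnn x) 0%N (intpart_sorted la).
  by move=> /(_ i j); rewrite !inE (leq_ltn_trans ij jn) => /(_ isT jn ij).
by rewrite (nth_default _ nj).
Qed.

Lemma rows_eq0 n (la : intpart n) k : (n <= k)%N -> rows la k = 0%N.
Proof. by move=> nk; rewrite /rows nth_default // (leq_trans (intpart_size la)). Qed.

Lemma rows_gt0 n (la : intpart n) k : (0 < rows la k)%N = (k < size la)%N.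
Proof.
case: (ltnP k (size la)) => [ks|sk]; last by rewrite /rows (nth_default _ sk).
by apply: (@intpart_gt0 _ la); rewrite mem_nth.
Qed.

Lemma sum_rows n (la : intpart n) N : (n <= N)%N -> (\sum_(k < N) rows la k)%N = n.
Proof.
move=> nN; rewrite -[RHS](intpart_sum la) sumnE (big_nth 0%N) big_mkord.
have sN := leq_trans (intpart_size la) nN.
rewrite (big_ord_widen _ _ sN) [RHS]big_mkcond; apply: eq_bigr => k _.
by case: ltnP => // sk; rewrite /rows (nth_default _ sk).
Qed.

Lemma rows_le n (la : intpart n) (i : 'I_n) : (rows la i <= n)%N.
Proof.
have := @sum_rows n la n (leqnn n); rewrite (bigD1 i) //= => fs.
by rewrite -[X in (_ <= X)%N]fs leq_addr.
Qed.

Lemma rows_inj n : injective (@rows n).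
Proof.
move=> la mu E; apply: val_inj; apply: (@eq_from_nth _ 0%N) => [|k _].
  apply/eqP; rewrite eqn_leq; apply/andP; split; rewrite leqNgt.
  - by rewrite -rows_gt0 E rows_gt0 ltnn.
  - by rewrite -rows_gt0 -E rows_gt0 ltnn.
by rewrite -[LHS]/(rows la k) E.
Qed.

Lemma intpart_of_rows n N f : nonincr f -> f N = 0%N ->
  (\sum_(k < N) f k)%N = n -> exists la : intpart n, rows la = f.
Proof.
move=> fd fN fs; have exM : exists m, f m == 0%N by exists N; rewrite fN.
case: (ex_minnP exM) => m /eqP fm m_min.
have f_gt0 k : (k < m)%N -> (0 < f k)%N.
  by move=> km; rewrite lt0n; apply/negP => /m_min; rewrite leqNgt km.
have f_eq0 k : (m <= k)%N -> f k = 0%N.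
  by move=> mk; apply/eqP; rewrite -leqn0 -fm fd.
have mN : (m <= N)%N by apply: m_min; rewrite fN.
have fP : is_partition n (mkseq f m).
  apply/and3P; split.
  - by apply: (homo_sorted (e := leq)) (iota_sorted _ _) => i j ij /=; apply: fd.
  - apply/mapP => -[k]; rewrite mem_iota add0n /= => /f_gt0 + fk.
    by rewrite -fk.
  - rewrite -fs sumnE big_map -[X in iota _ X]subn0 -/(index_iota _ _) big_mkord.
    rewrite (big_ord_widen _ _ mN) big_mkcond; apply/eqP/eq_bigr => k _.
    by case: ltnP => // mk; rewrite f_eq0.
exists (IntPart fP); apply/funext => k; rewrite /rows /=.
case: (ltnP k m) => km; first by rewrite nth_mkseq.
by rewrite nth_default ?size_mkseq // f_eq0.
Qed.

Lemma addrow_intpart n (la : intpart n) i : (i <= n)%N -> addable (rows la) i ->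
  exists mu : intpart n.+1, rows mu = addrow (rows la) i.
Proof.
move=> le_in ai; apply: (@intpart_of_rows _ n.+1).
- by apply: nonincr_addrow => //; exact: rows_nonincr.
- by rewrite /addrow rows_eq0 // gtn_eqF.
have lt_in : (i < n.+1)%N by [].
rewrite big_split /= sum_rows // (bigD1 (Ordinal lt_in)) //= eqxx big1 ?addn1 //.
by move=> k; rewrite -val_eqE /= => /negbTE ->.
Qed.

Lemma delrow_intpart n (mu : intpart n.+1) i : (rows mu i.+1 < rows mu i)%N ->
  exists la : intpart n, addrow (rows la) i = rows mu /\ addable (rows la) i.
Proof.
move=> lt_mu; have mu_d := @rows_nonincr _ mu.
have le_in : (i < n.+1)%N.
  by rewrite ltnNge; apply/negP => ni; move: lt_mu; rewrite (rows_eq0 mu ni) ltn0.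
pose f k := (rows mu k - (k == i))%N.
have fd : nonincr f.
  move=> j k jk; rewrite /f; have := mu_d _ _ jk.
  case: (eqVneq j i) => [ji|_] h; last first.
    by rewrite subn0 (leq_trans (leq_subr _ _)).
  case: (eqVneq k i) => [ki|ki]; first by rewrite ki ji.
  rewrite subn0 ji subn1 -ltnS prednK; last exact: leq_ltn_trans lt_mu.
  apply: leq_ltn_trans lt_mu; apply: mu_d.
  by rewrite ltn_neqAle eq_sym ki -ji.
have f_add : addrow f i = rows mu.
  apply/funext => k; rewrite /addrow /f subnK //; case: eqP => // ->.
  exact: leq_ltn_trans lt_mu.
have fs : (\sum_(k < n.+1) f k)%N = n.
  have : (\sum_(k < n.+1) addrow f i k)%N = n.+1 by rewrite f_add sum_rows.
  rewrite big_split /= (_ : \sum_(k < n.+1) (val k == i) = 1)%N ?addn1 => [[]//|].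
  rewrite (bigD1 (Ordinal le_in)) //= eqxx big1 // => k.
  by rewrite -val_eqE /= => /negbTE ->.
have [|la laf] := intpart_of_rows fd _ fs.
  by rewrite /f rows_eq0.
exists la; rewrite laf; split => //; rewrite /addable.
case: i => // i in lt_mu le_in f fd f_add fs laf *.
rewrite /= /f eqxx (_ : (i == i.+1) = false) ?subn0; last by rewrite ltn_eqF.
rewrite (leq_trans _ (mu_d i i.+1 (leqnSn i))) // subn1 prednK //.
exact: leq_ltn_trans lt_mu.
Qed.

End Rows.

(** * Jack measure as a hook product of rows *)

Section Jack.
Variables (R : realType) (alpha : R).
Hypothesis alpha_gt0 : 0 < alpha.

Lemma card_ltn_ord N (P : pred 'I_N) : #|[set k | P k]| = (\sum_(k < N) P k)%N.
Proof. by rewrite cardsE -sum1_card big_mkcond. Qed.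

Lemma armE n (la : intpart n) (s : 'I_n * 'I_n) : (s.2 < rows la s.1)%N ->
  (arm la s)%:R = (rows la s.1)%:R - (s.2 : nat)%:R - 1 :> R.
Proof.
case: s => i j /= jf; have fn : (rows la i <= n)%N.
  exact: rows_le.
have -> : arm la (i, j) = (rows la i - j.+1)%N.
  rewrite /arm (_ : [set t in diagram la | _] =
     (pair i) @: [set k : 'I_n | (j < k < rows la i)%N]).
    rewrite card_imset; last by move=> a b [].
    rewrite card_ltn_ord.
    rewrite -(big_mkord xpredT (fun k => (j < k < rows la i)%N : nat)).
    rewrite (@big_cat_nat _ _ _ j.+1) //= big_nat big1 => [|k /andP[_ kj]]; last first.
      by rewrite ltnNge -ltnS kj.
    rewrite add0n (@big_cat_nat _ _ _ (rows la i)) //=.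
    rewrite (eq_big_nat _ _ (F2 := fun=> 1%N)) => [|k ->//].
    rewrite sum_nat_const_nat muln1 big_nat big1 ?addn0 // => k /andP[ik _].
    by rewrite [(k < _)%N]ltnNge ik andbF.
  apply/setP => -[a b]; rewrite !inE /=; apply/idP/imsetP => [|[k]].
    by move=> /and3P[bf /eqP <- jb]; exists b; rewrite // inE jb.
  by rewrite inE => /andP[jk kf] [-> ->]; rewrite eqxx jk kf.
by rewrite natrB // -natr1; ring.
Qed.

Lemma legE n (la : intpart n) (s : 'I_n * 'I_n) : (s.2 < rows la s.1)%N ->
  (leg la s)%:R = (colh n (rows la) s.2)%:R - (s.1 : nat)%:R - 1 :> R.
Proof.
case: s => i j /= jf.
have -> : leg la (i, j) = (colh n (rows la) j - i.+1)%N.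
  rewrite /leg (_ : [set t in diagram la | _] =
     (pair^~ j) @: [set k : 'I_n | (i < k)%N && (j < rows la k)%N]).
    rewrite card_imset; last by move=> a b [].
    rewrite card_ltn_ord.
    rewrite -(big_mkord xpredT (fun k => ((i < k)%N && (j < rows la k)%N) : nat)).
    rewrite /colh -(big_mkord xpredT (fun k => (j < rows la k)%N : nat)).
    rewrite [LHS](@big_cat_nat _ _ _ i.+1) //=.
    rewrite [X in _ = (X - _)%N](@big_cat_nat _ _ _ i.+1) //=.
    rewrite big_nat big1 => [|k /andP[_ kj]]; last by rewrite ltnNge -ltnS kj.
    rewrite [X in _ = (X + _ - _)%N](eq_big_nat _ _ (F2 := fun=> 1%N)) =>
      [|k /andP[_ ki]].
      rewrite sum_nat_const_nat muln1 subn0 addKn add0n.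
      by apply: eq_big_nat => k /andP[->].
    by rewrite (leq_trans jf) // rows_nonincr.
  apply/setP => -[a b]; rewrite !inE /=; apply/idP/imsetP => [|[k]].
    by move=> /and3P[bf /eqP <- jb]; exists a; rewrite // inE jb.
  by rewrite inE => /andP[jk kf] [-> ->]; rewrite eqxx jk kf.
have := colh_gt (@rows_nonincr _ la) (ltn_ord i) jf.
by move=> h; rewrite natrB // -natr1; ring.
Qed.

Lemma jackE n (la : intpart n) : jack alpha la = jack_weight alpha n (rows la).
Proof.
rewrite /jack /jack_weight /hook; congr (_ / _).
transitivity (\prod_(i < n) \prod_(j < n | (j < rows la i)%N)
    hook_factor alpha ((rows la i)%:R - j%:R - 1) ((colh n (rows la) j)%:R - i%:R - 1)).
  rewrite pair_big_dep /=; apply: eq_big => [[i j]|[i j]]; rewrite inE //= => jf.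
  by rewrite armE // legE.
apply: eq_bigr => i _.
rewrite /hook_row big_mkord.
by rewrite (big_ord_widen _ (fun j => hook_factor alpha ((rows la i)%:R - j%:R - 1)
  ((colh n (rows la) j)%:R - i%:R - 1)) (rows_le la i)).
Qed.
End Jack.

(** * Growth recursion and moments under Jack measure *)

Section JackExp.
Variables (R : realType) (alpha : R).
Hypothesis alpha_gt0 : 0 < alpha.
Implicit Types (f : nat -> nat) (n i j k N : nat).

Definition jack_exp n (F : (nat -> nat) -> R) : R :=
  \sum_(la : intpart n) jack alpha la * F (rows la).

Lemma not_addable_up n f i : nonincr f -> (i <= n)%N -> ~~ addable f i ->
  up_prob alpha n f i = 0.
Proof.
rewrite /addable; case: i => [|i] //= fd le_in; rewrite -leqNgt => fi.
by apply: up_eq0 => //; apply/eqP; rewrite eqn_leq fi fd.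
Qed.

(** At most one [la] becomes [mu] by a box in row [i]. If row [i] of [mu] can be shortened, the sum
    is its single term, given by detailed balance; otherwise [down_prob] and every term of the sum
    vanish. *)
Lemma jack_down n (mu : intpart n.+1) i : (i <= n)%N ->
  jack alpha mu * down_prob alpha n (rows mu) i =
  \sum_(la : intpart n | `[< rows mu = addrow (rows la) i >])
     jack alpha la * up_prob alpha n (rows la) i.
Proof.
move=> le_in.
have balance (la : intpart n) : addable (rows la) i -> rows mu = addrow (rows la) i ->
    jack alpha mu * down_prob alpha n (rows mu) i =
    jack alpha la * up_prob alpha n (rows la) i.
  move=> ai E; rewrite !jackE // E jack_weight_balance //; first exact: rows_nonincr.
  exact: rows_eq0.
case: (ltnP (rows mu i.+1) (rows mu i)) => [lt_mu|ge_mu].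
  have [la [laE ai]] := delrow_intpart lt_mu.
  rewrite (balance la) // (bigD1 la) /=; last exact/asboolP.
  rewrite big1 ?addr0 // => nu /andP[/asboolP nuE].
  case/negP; apply/eqP/rows_inj/funext => k.
  by have := congr1 (fun g => g k) (etrans laE nuE) => /addIn.
have mu_i : rows mu i.+1 = rows mu i.
  by apply/eqP; rewrite eqn_leq ge_mu (@rows_nonincr _ mu i).
rewrite (down_eq0 _ le_in (rows_eq0 mu (leqnn _)) mu_i) mulr0 big1 // => la /asboolP E.
rewrite not_addable_up ?mulr0 //; first exact: rows_nonincr.
apply/negP => ai; move: mu_i; rewrite E /addrow eqxx.
rewrite (_ : (i.+1 == i) = false); last by rewrite gtn_eqF.
by have := @rows_nonincr _ la i i.+1 (leqnSn i); lia.
Qed.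

(** The decay probabilities of each [mu] sum to one and are inserted as a factor; [jack_down] turns
    them into growth probabilities, after which the sum over [mu] collapses. *)
Lemma jack_exp_recr n F : jack_exp n.+1 F =
  jack_exp n (fun f => \sum_(i < n.+1) up_prob alpha n f i * F (addrow f i)).
Proof.
transitivity (\sum_(mu : intpart n.+1) \sum_(i < n.+1)
  \sum_(la : intpart n | `[< rows mu = addrow (rows la) i >])
     jack alpha la * up_prob alpha n (rows la) i * F (rows mu)).
  apply: eq_bigr => mu _; rewrite -[jack alpha mu]mulr1.
  rewrite -(sum_down alpha_gt0 (@rows_nonincr _ mu) (sum_rows mu (leqnn _))).
  rewrite mulr_sumr mulr_suml; apply: eq_bigr => i _.
  by rewrite jack_down -1?ltnS // mulr_suml.
rewrite exchange_big /= /jack_exp; under [RHS]eq_bigr do rewrite mulr_sumr.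
rewrite [RHS]exchange_big; apply: eq_bigr => i _ /=.
under eq_bigr do rewrite big_mkcond.
rewrite exchange_big; apply: eq_bigr => la _ /=; rewrite -big_mkcond /=.
have le_in : (i <= n)%N by rewrite -ltnS.
have [ai|nai] := boolP (addable (rows la) i); last first.
  rewrite not_addable_up ?mul0r ?mulr0 ?big1 // => [mu _|]; last exact: rows_nonincr.
  by rewrite mul0r.
have [mu muE] := addrow_intpart le_in ai.
rewrite (bigD1 mu) /=; last exact/asboolP.
rewrite muE [X in _ + X]big1 => [|nu /andP[/asboolP nuE]].
  by rewrite addr0 -[LHS]mulrA.
by case/negP; apply/eqP/rows_inj; rewrite nuE.
Qed.

Lemma jack_ge0 n (la : intpart n) : 0 <= jack alpha la.
Proof. by rewrite jackE; apply: jack_weight_ge0 => //; exact: rows_nonincr. Qed.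

Lemma eq_jack_exp n F G : (forall la : intpart n, F (rows la) = G (rows la)) ->
  jack_exp n F = jack_exp n G.
Proof. by move=> FG; apply: eq_bigr => la _; rewrite FG. Qed.

Lemma le_jack_exp n F G : (forall la : intpart n, F (rows la) <= G (rows la)) ->
  jack_exp n F <= jack_exp n G.
Proof. by move=> FG; apply: ler_sum => la _; rewrite ler_wpM2l ?jack_ge0. Qed.

Lemma jack_expD n F G :
  jack_exp n (fun f => F f + G f) = jack_exp n F + jack_exp n G.
Proof. by rewrite -big_split; apply: eq_bigr => la _; rewrite mulrDr. Qed.

Lemma jack_expB n F G :
  jack_exp n (fun f => F f - G f) = jack_exp n F - jack_exp n G.
Proof. by rewrite -sumrB; apply: eq_bigr => la _; rewrite mulrBr. Qed.

Lemma jack_expZ n a F : jack_exp n (fun f => a * F f) = a * jack_exp n F.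
Proof. by rewrite mulr_sumr; apply: eq_bigr => la _; rewrite mulrCA. Qed.

Lemma ler_norm_jack_exp n F : `|jack_exp n F| <= jack_exp n (fun f => `|F f|).
Proof.
apply: le_trans (ler_norm_sum _ _ _) _; apply: ler_sum => la _.
by rewrite normrM (ger0_norm (jack_ge0 la)).
Qed.

Lemma intpart0_eq (la mu : intpart 0) : la = mu.
Proof. by apply: rows_inj; apply/funext => k; rewrite !rows_eq0. Qed.

Lemma jack_exp0 F : jack_exp 0 F = F (fun=> 0%N).
Proof.
have la0 : is_partition 0 [::] by [].
rewrite /jack_exp (big_pred1 (IntPart la0)) => [|la]; last first.
  by apply/esym/eqP/intpart0_eq.
rewrite (_ : rows _ = fun=> 0%N); last by apply/funext => k; rewrite rows_eq0.
rewrite jackE // /jack_weight /hook big_ord0; rewrite fact0 expr0 invr1; ring.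
Qed.

Lemma rows_moments n (la : intpart n) (f := rows la) :
  [/\ \sum_(i < n.+1) up_prob alpha n f i = 1,
      \sum_(i < n.+1) up_prob alpha n f i * content alpha f i = 0,
      \sum_(i < n.+1) up_prob alpha n f i * content alpha f i ^+ 2 = alpha * n%:R &
      \sum_(i < n.+1) up_prob alpha n f i * content alpha f i ^+ 4 =
        (alpha * n%:R) ^+ 2 / 2 + up_p4 alpha n f / 4].
Proof.
apply: up_moments => //; first exact: rows_nonincr.
  exact: rows_eq0.
exact: sum_rows.
Qed.

Lemma sum_up_quadratic n (la : intpart n) (f := rows la) (a b d : R) :
  \sum_(i < n.+1)
     up_prob alpha n f i * (a + b * content alpha f i + d * content alpha f i ^+ 2)
  = a + d * (alpha * n%:R).
Proof.
have [m0 m1 m2 _] := rows_moments la.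
rewrite (eq_bigr (fun i : 'I_n.+1 => a * up_prob alpha n f i +
  b * (up_prob alpha n f i * content alpha f i) +
  d * (up_prob alpha n f i * content alpha f i ^+ 2))) => [|i _]; last by ring.
by rewrite !big_split -!mulr_sumr /= m0 m1 m2; ring.
Qed.

Lemma jack_exp1 n : jack_exp n (fun=> 1) = 1.
Proof.
elim: n => [|n IH]; first exact: jack_exp0.
rewrite jack_exp_recr -[RHS]IH; apply: eq_jack_exp => la.
by under eq_bigr do rewrite mulr1; case: (rows_moments la).
Qed.

(** The box contents summed row by row; the column indices of row [k] add up to ['C(f k, 2)]. *)
Definition content_sum N f : R :=
  \sum_(k < N) (alpha * 'C(f k, 2)%:R - k%:R * (f k)%:R).

Lemma sum_addrow N f i (H : nat -> nat -> R) : (i < N)%N ->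
  \sum_(k < N) H (addrow f i k) k =
  \sum_(k < N) H (f k) k + (H (f i).+1 i - H (f i) i).
Proof.
move=> iN; rewrite [LHS](bigD1 (Ordinal iN)) //=.
rewrite [X in _ = X + _](bigD1 (Ordinal iN)) //= {1}/addrow eqxx addn1.
set T := \sum_(k < N | _) H (f k) k; have -> : \sum_(k < N | k != Ordinal iN)
    H (addrow f i k) k = T.
  apply: eq_bigr => k; rewrite -val_eqE /= /addrow => /negbTE ->.
  by rewrite addn0.
ring.
Qed.

Lemma content_sum_addrow n f i : (i <= n)%N -> f n = 0%N ->
  content_sum n.+1 (addrow f i) = content_sum n f + content alpha f i.
Proof.
move=> le_in fn; have -> : content_sum n f = content_sum n.+1 f.
  by rewrite /content_sum big_ord_recr /= fn bin0n /=; ring.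
rewrite /content_sum (sum_addrow _ (fun r k => alpha * 'C(r, 2)%:R - k%:R * r%:R)) //.
by congr (_ + _); rewrite binS bin1 natrD -natr1 /content; ring.
Qed.

(** The increment is a second difference of fourth powers, hence quadratic in the content, so its
    conditional mean is known and [jack_exp_p4] follows by induction. *)
Lemma up_p4_addrow n f i : (i <= n)%N -> f n = 0%N -> f n.+1 = 0%N ->
  up_p4 alpha n.+1 (addrow f i) = up_p4 alpha n f +
   (12 * alpha * content alpha f i ^+ 2 + 12 * alpha * (alpha - 1) * content alpha f i
    + (4 * alpha ^+ 3 - 6 * alpha ^+ 2 + 4 * alpha)).
Proof.
move=> le_in fn fn1; have -> : up_p4 alpha n f = up_p4 alpha n.+1 f.
  rewrite /up_p4 [in RHS]big_ord_recr [X in _ = _ - X]big_ord_recr /=.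
  rewrite [content alpha f n.+1]/content [content alpha f n]/content fn fn1 -natr1.
  by ring.
rewrite /up_p4 /content.
rewrite (sum_addrow _ (fun r k => (alpha * r%:R - k%:R) ^+ 4)) ?ltnS ?leqW //.
rewrite (sum_addrow _ (fun r k => (alpha * r%:R - k%:R - 1) ^+ 4)) //.
by rewrite -natr1; ring.
Qed.

Lemma jack_exp_p4 n : jack_exp n (up_p4 alpha n) =
  6 * alpha ^+ 2 * n%:R * (n%:R - 1) +
  (4 * alpha ^+ 3 - 6 * alpha ^+ 2 + 4 * alpha) * n%:R.
Proof.
elim: n => [|n IH].
  rewrite jack_exp0 /up_p4 big_ord_recl !big_ord0 /content.
  by rewrite (_ : (@ord0 0 : nat) = 0%N) //; ring.
rewrite jack_exp_recr.
set kap := 4 * alpha ^+ 3 - _ + _ in IH *.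
transitivity (jack_exp n
  (fun f => up_p4 alpha n f + (12 * alpha * (alpha * n%:R) + kap) * 1)).
  apply: eq_jack_exp => la; set f := rows la.
  have := sum_up_quadratic la (up_p4 alpha n f + kap) (12 * alpha * (alpha - 1))
    (12 * alpha).
  rewrite -/f => E; transitivity (up_p4 alpha n f + kap + 12 * alpha * (alpha * n%:R)).
    rewrite -E; apply: eq_bigr => i _; congr (_ * _).
    have le_in : (i <= n)%N by rewrite -ltnS.
    rewrite (up_p4_addrow le_in (rows_eq0 la (leqnn n)) (rows_eq0 la (leqnSn n))).
    by rewrite -/f -/kap; ring.
  by ring.
rewrite jack_expD jack_expZ jack_exp1 IH -natr1; ring.
Qed.
End JackExp.

(** * The Gaussian distribution function *)

Section Gauss.
Local Open Scope classical_set_scope.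
Variable R : realType.
Implicit Types x y : R.
Local Notation mu := (@lebesgue_measure R).

Definition gauss_pdf x : R := (Num.sqrt (2 * pi))^-1 * expR (- (x ^+ 2) / 2).

Lemma normal_pdf01 : normal_pdf 0 1 = gauss_pdf.
Proof.
apply/funext => x; rewrite normal_pdfE ?oner_neq0 //.
rewrite /normal_peak /normal_fun /gauss_pdf subr0 expr1n mul1r.
by rewrite -mulr_natl.
Qed.

Lemma integrable_gauss_pdf : mu.-integrable setT (EFin \o gauss_pdf).
Proof. by rewrite -normal_pdf01; exact: integrable_normal_pdf. Qed.

Lemma gauss_cdfE x : gauss_cdf x = Rintegral mu `]-oo, x] gauss_pdf.
Proof.
rewrite /gauss_cdf /gauss_pdf RintegralZl //.
have c0 : Num.sqrt (2 * pi) != 0 :> R.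
  by rewrite gt_eqF // sqrtr_gt0 mulr_gt0 // pi_gt0.
have : mu.-integrable setT (fun y => (Num.sqrt (2 * pi))%:E * (gauss_pdf y)%:E)%E.
  by apply: integrableZl => //; exact: integrable_gauss_pdf.
rewrite (_ : (fun y => _) = EFin \o fun y => expR (- (y ^+ 2) / 2)); last first.
  by apply/funext => y; rewrite /= -EFinM /gauss_pdf mulVKf.
exact: integrableS.
Qed.

Lemma is_derive_gauss_cdf x : is_derive x 1 (@gauss_cdf R) (gauss_pdf x).
Proof.
have -> : @gauss_cdf R = fun y => Rintegral mu `]-oo, y] gauss_pdf.
  by apply/funext => y; exact: gauss_cdfE.
have x1 : x < x + 1 by rewrite ltrDl.
have [|||dF F'] := @continuous_FTC1 _ gauss_pdf -oo%O x (x + 1) x1.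
- by apply: integrableS integrable_gauss_pdf.
- by rewrite ltNyr.
- by rewrite -normal_pdf01; apply: continuous_normal_pdf; exact: oner_neq0.
by split; [exact: dF|rewrite -derive1E F'].
Qed.

Let N01 : probability (measurableTypeR R) R := @normal_prob R 0 1.

Lemma gauss_cdf_prob x : (gauss_cdf x)%:E = N01 `]-oo, x].
Proof.
rewrite gauss_cdfE /Rintegral fineK -?normal_pdf01 // normal_pdf01.
apply: integrable_fin_num => //.
by apply: integrableS integrable_gauss_pdf.
Qed.

(** Under [N01] the identity is a random variable with distribution function [gauss_cdf], which
    thereby gets its limits at infinity. *)
Let idTR : measurableTypeR R -> R := idfun.

#[local] HB.instance Definition _ :=
  @isMeasurableFun.Build _ _ _ _ idTR (@measurable_id _ _ setT).

Let X := idTR : {RV N01 >-> R}.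

Let cdf_gauss x : cdf X x = (gauss_cdf x)%:E.
Proof. by rewrite gauss_cdf_prob. Qed.

Lemma gauss_cdf_ge0 x : 0 <= gauss_cdf x.
Proof. by rewrite -lee_fin gauss_cdf_prob. Qed.

Lemma gauss_cdf_le1 x : gauss_cdf x <= 1.
Proof. by rewrite -lee_fin gauss_cdf_prob probability_le1. Qed.

Lemma cvg_gauss_cdfy : gauss_cdf x @[x --> +oo] --> (1 : R).
Proof.
have := cvg_cdfy1 X; rewrite (_ : cdf X = EFin \o @gauss_cdf R); last first.
  by apply/funext => x; exact: cdf_gauss.
by move/fine_cvgP => [].
Qed.

Lemma cvg_gauss_cdfNy : gauss_cdf x @[x --> -oo] --> (0 : R).
Proof.
have := cvg_cdfNy0 X; rewrite (_ : cdf X = EFin \o @gauss_cdf R); last first.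
  by apply/funext => x; exact: cdf_gauss.
by move/fine_cvgP => [].
Qed.
End Gauss.

(** * Taylor and scaling estimates for the Gaussian *)

Section GaussCalculus.
Local Open Scope classical_set_scope.
Variable R : realType.
Implicit Types x y t w q s u : R.
Local Notation Phi := (@gauss_cdf R).
Local Notation phi := (@gauss_pdf R).

Lemma mvt_ball (f df : R -> R) a b : a <= b ->
    (forall x, is_derive x 1 f (df x)) ->
  exists2 c, a <= c <= b & f b - f a = df c * (b - a).
Proof.
move=> ab fd; have [|c cab E] := @MVT_segment _ f df a b ab (fun x _ => fd x).
  apply: continuous_subspaceT => x.
  apply: differentiable_continuous; apply/derivable1_diffP.
  by case: (fd x).
by exists c => //; rewrite in_itv in cab.
Qed.

Lemma mvt_norm_le (f df : R -> R) a b M : a <= b ->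
    (forall x, is_derive x 1 f (df x)) ->
    (forall x, a <= x <= b -> `|df x| <= M) ->
  `|f b - f a| <= M * (b - a).
Proof.
move=> ab fd dfM; have [c cab ->] := mvt_ball ab fd.
by rewrite normrM [`|b - a|]ger0_norm ?subr_ge0 // ler_wpM2r ?subr_ge0 // dfM.
Qed.

(** One stage of a Taylor remainder estimate; the factor [1 / k.+1] that integration would gain is
    given up. *)
Lemma mvt_pow_le (f df : R -> R) k M t : 0 <= M -> f 0 = 0 ->
    (forall x, is_derive x 1 f (df x)) ->
    (forall x, `|df x| <= M * `|x| ^+ k) ->
  `|f t| <= M * `|t| ^+ k.+1.
Proof.
move=> M0 f0 fd dfM.
have bound x : `|x| <= `|t| -> `|df x| <= M * `|t| ^+ k.
  by move=> xt; rewrite (le_trans (dfM x)) // ler_wpM2l // lerXn2r ?nnegrE.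
rewrite exprSr mulrA; have [t0|t0] := leP 0 t.
  rewrite -[f t]subr0 -f0 [X in _ * X]ger0_norm // -[X in _ * X]subr0.
  apply: (mvt_norm_le t0 fd) => x /andP[x0 xt]; apply: bound.
  by rewrite !ger0_norm.
rewrite -normrN -[- f t]add0r -f0 [X in _ * X]ltr0_norm // -[X in _ * X]add0r.
apply: (mvt_norm_le (ltW t0) fd) => x /andP[x0 xt]; apply: bound.
by rewrite (ltr0_norm t0) ler0_norm // lerN2.
Qed.

Definition gauss_c : R := (Num.sqrt (2 * pi))^-1.

Lemma gauss_c_gt0 : 0 < gauss_c.
Proof. by rewrite invr_gt0 sqrtr_gt0 mulr_gt0 // pi_gt0. Qed.

Lemma gauss_c_le1 : gauss_c <= 1.
Proof.
rewrite invf_le1 ?sqrtr_gt0 ?mulr_gt0 ?pi_gt0 //.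
have pi2 := pi_ge2 R; have : 1 <= 2 * pi :> R by lra.
by move/ler_wsqrtr; rewrite sqrtr1.
Qed.

Lemma gauss_pdf_ge0 x : 0 <= phi x.
Proof. by rewrite mulr_ge0 ?expR_ge0 // ltW // gauss_c_gt0. Qed.

Lemma is_derive_expsq x :
  is_derive x 1 (fun y : R => expR (- (y ^+ 2) / 2)) (- x * expR (- (x ^+ 2) / 2)).
Proof.
apply: is_derive_eq.
by rewrite /GRing.scale /=; field.
Qed.

Lemma is_derive_gauss_pdf x : is_derive x 1 phi (- x * phi x).
Proof.
rewrite /gauss_pdf; have d := is_derive_expsq x.
by apply: is_derive_eq; rewrite /GRing.scale /=; ring.
Qed.

Lemma expR_ge_sqr t : 0 <= t -> t ^+ 2 / 4 <= expR t.
Proof.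
move=> t0; have -> : expR t = expR (t / 2) ^+ 2.
  by rewrite -expRM_natr; congr expR; field.
have h := expR_ge1Dx (t / 2).
have h0 : 0 <= t / 2 by lra.
have h1 : t / 2 <= expR (t / 2) by lra.
by have := lerXn2r 2 h0 (le_trans h0 h1) h1; rewrite expr_div_n; lra.
Qed.

Lemma gauss_pdf_bounds x :
  [/\ phi x <= 1, x ^+ 2 * phi x <= 2 & x ^+ 4 * phi x <= 16].
Proof.
have [c0 c1] := (gauss_c_gt0, gauss_c_le1).
pose t := x ^+ 2 / 2; have t0 : 0 <= t by rewrite divr_ge0 // sqr_ge0.
have phiE : phi x = gauss_c * expR (- t).
  by rewrite /gauss_pdf /t mulNr.
have e0 := expR_gt0 (- t).
have phi_le : phi x <= expR (- t) by rewrite phiE ler_piMl // ltW.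
have eM : expR t * expR (- t) = 1 by rewrite -expRD subrr expR0.
have le1 := expR_ge1Dx t.
have h1 : expR (- t) <= 1 by rewrite expR_le1 oppr_le0.
have h2 : t * expR (- t) <= 1.
  by rewrite -eM ler_wpM2r ?(ltW e0) //; lra.
have h4 : t ^+ 2 * expR (- t) <= 4.
  have := ler_wpM2r (ltW e0) (expR_ge_sqr t0); rewrite eM; lra.
have x2 : x ^+ 2 = 2 * t by rewrite /t; field.
have x4 : x ^+ 4 = 4 * t ^+ 2 by rewrite /t; field.
split; first exact: le_trans h1.
- have := ler_wpM2l (sqr_ge0 x) phi_le; rewrite x2; lra.
- have := ler_wpM2l (exprn_even_ge0 x (isT : ~~ odd 4)) phi_le; rewrite x4; lra.
Qed.

Lemma gauss_pdf_bounds13 x : `|x * phi x| <= 2 /\ `|x ^+ 3 * phi x| <= 9.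
Proof.
have [b0 b2 b4] := gauss_pdf_bounds x; have p0 := gauss_pdf_ge0 x.
rewrite [`|x * _|]normrM [`|x ^+ 3 * _|]normrM (ger0_norm p0) normrX.
have x2 : x ^+ 2 = `|x| ^+ 2 by rewrite real_normK // num_real.
have x4 : x ^+ 4 = `|x| ^+ 4 by rewrite -normrX ger0_norm // exprn_even_ge0.
move: b2 b4; rewrite x2 x4; set u := `|x| => b2 b4.
have h1 : u <= (1 + u ^+ 2) / 2 by have := sqr_ge0 (1 - u); lra.
have h3 : u ^+ 3 <= (u ^+ 2 + u ^+ 4) / 2.
  by have := sqr_ge0 (u - u ^+ 2); lra.
by have := ler_wpM2r p0 h1; have := ler_wpM2r p0 h3; lra.
Qed.

Lemma is_derive_comp_affine (f df : R -> R) a b x :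
    (forall x, is_derive x 1 f (df x)) ->
  is_derive x 1 (fun s => f (a + b * s)) (b * df (a + b * x)).
Proof.
move=> fd; have h : is_derive x 1 (fun s => a + b * s) b.
  by apply: is_derive_eq; rewrite /GRing.scale /=; ring.
have := @is_derive1_comp R f (fun s => a + b * s) x (df (a + b * x)) b (fd _) h.
by rewrite mulrC.
Qed.

(** The third derivative [(y ^+ 2 - 1) * phi y] of [Phi] is bounded by 3, and [g2], [g1], [g0] are,
    up to sign, the successive remainders that lead from it back to [Phi]. *)
Lemma gauss_cdf_taylor y t :
  `|Phi (y - t) - Phi y + t * phi y + t ^+ 2 / 2 * (y * phi y)| <= 3 * `|t| ^+ 3.
Proof.
pose g2 s := (y - s) * phi (y - s) - y * phi y.
pose g1 s := phi (y - s) - phi y - s * (y * phi y).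
pose g0 s := Phi (y - s) - Phi y + s * phi y + s ^+ 2 / 2 * (y * phi y).
have dphi s : is_derive s 1 (fun u => phi (y - u)) ((y - s) * phi (y - s)).
  have := is_derive_comp_affine y (-1) s is_derive_gauss_pdf.
  rewrite (_ : (fun _ => _) = fun u => phi (y - u)); last first.
    by apply/funext => u; rewrite mulN1r.
  by rewrite !mulN1r mulNr opprK.
have dPhi s : is_derive s 1 (fun u => Phi (y - u)) (- phi (y - s)).
  have := is_derive_comp_affine y (-1) s (@is_derive_gauss_cdf R).
  rewrite (_ : (fun _ => _) = fun u => Phi (y - u)); last first.
    by apply/funext => u; rewrite mulN1r.
  by rewrite !mulN1r.
have d0 s : is_derive s 1 g0 (- g1 s).
  have h := dPhi s; rewrite /g0; apply: is_derive_eq.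
  by rewrite /GRing.scale /= /g1; field.
have d1 s : is_derive s 1 g1 (g2 s).
  have h := dphi s; rewrite /g1; apply: is_derive_eq.
  by rewrite /GRing.scale /= /g2; ring.
have d2 s : is_derive s 1 g2 (((y - s) ^+ 2 - 1) * phi (y - s)).
  have h := dphi s; rewrite /g2; apply: is_derive_eq.
  by rewrite /GRing.scale /=; ring.
have b3 s : `|((y - s) ^+ 2 - 1) * phi (y - s)| <= 3 * `|s| ^+ 0.
  have [b0 b2 _] := gauss_pdf_bounds (y - s); have p0 := gauss_pdf_ge0 (y - s).
  rewrite expr0 mulr1 ler_norml.
  have := mulr_ge0 (sqr_ge0 (y - s)) p0; lra.
have z2 : g2 0 = 0 by rewrite /g2 !subr0 subrr.
have z1 : g1 0 = 0 by rewrite /g1 !subr0; ring.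
have z0 : g0 0 = 0 by rewrite /g0 !subr0; ring.
have b2 s := mvt_pow_le s (ler0n R 3) z2 d2 b3.
have b1 s := mvt_pow_le s (ler0n R 3) z1 d1 b2.
apply: (mvt_pow_le t (ler0n R 3) z0 d0) => s; rewrite normrN; exact: b1.
Qed.

(** The term in [y * phi y] is the quadratic term of [gauss_cdf_taylor] averaged over a centred step
    of variance [p ^+ 2 - 1]. Lindeberg replacement rests on this agreement. *)
Lemma gauss_cdf_scale y p : 1 <= p ->
  `|Phi (y / p) - Phi y + (p ^+ 2 - 1) / 2 * (y * phi y)| <= 12 * (p ^+ 2 - 1) ^+ 2.
Proof.
move=> p1; have p0 : 0 < p by lra.
pose q := p^-1; have q0 : 0 < q by rewrite invr_gt0.
have q1 : q <= 1 by rewrite invf_le1.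
have qp : q * p = 1 by rewrite mulVf // gt_eqF.
pose g s := y * phi (y * s).
pose dg s := - (y ^+ 3 * s) * phi (y * s).
have gd s : is_derive s 1 g (dg s).
  have := is_derive_comp_affine 0 y s is_derive_gauss_pdf.
  rewrite (_ : (fun _ => _) = fun u => phi (y * u)); last first.
    by apply/funext => u; rewrite add0r.
  rewrite add0r => h; rewrite /g; apply: is_derive_eq.
  by rewrite /GRing.scale /= /dg; ring.
(* For uniformity in [y], the factor [y ^+ 3 * s] is written [(y * s) ^+ 3 / s ^+ 2] and its cube
   absorbed by the density. *)
have dg_le s : q <= s <= 1 -> `|dg s| <= 9 * p ^+ 2.
  move=> /andP[qs s1]; have s0 : 0 < s by lra.
  have [_ h] := gauss_pdf_bounds13 (y * s).
  have -> : dg s = - ((y * s) ^+ 3 * phi (y * s)) / s ^+ 2.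
    by rewrite /dg; field; rewrite gt_eqF.
  rewrite normrM normrN normfV [`|s ^+ 2|]ger0_norm ?sqr_ge0 //.
  apply: ler_pM => //; first by rewrite invr_ge0 sqr_ge0.
  have -> : p ^+ 2 = (q ^+ 2)^-1 by rewrite /q exprVn invrK.
  by rewrite lef_pV2 ?posrE ?exprn_gt0 // lerXn2r ?nnegrE // ltW.
pose H s := Phi (y * s) - s * (y * phi y).
have Hd s : is_derive s 1 H (g s - g 1).
  have := is_derive_comp_affine 0 y s (@is_derive_gauss_cdf R).
  rewrite (_ : (fun _ => _) = fun u => Phi (y * u)); last first.
    by apply/funext => u; rewrite add0r.
  rewrite add0r => h; rewrite /H; apply: is_derive_eq.
  by rewrite /GRing.scale /= /g mulr1; ring.
have dH_le s : q <= s <= 1 -> `|g s - g 1| <= 9 * p ^+ 2 * (1 - q).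
  move=> /andP[qs s1]; rewrite distrC.
  apply: (le_trans (mvt_norm_le s1 gd (M := 9 * p ^+ 2) _)) => [u /andP[su u1]|].
    by apply: dg_le; rewrite u1 (le_trans qs).
  by rewrite ler_wpM2l ?mulr_ge0 ?sqr_ge0 //; lra.
have := mvt_norm_le q1 Hd dH_le; rewrite distrC /H mulr1 mul1r -/q.
have -> : 9 * p ^+ 2 * (1 - q) * (1 - q) = 9 * (p - 1) ^+ 2.
  have <- : p * (1 - q) = p - 1 by rewrite mulrBr mulr1 [p * q]mulrC qp.
  by ring.
set D := Phi (y * q) - _ - _ => hD.
(* The mean value steps produce the coefficient [1 - q] in place of [(p ^+ 2 - 1) / 2]; [e] is the
   discrepancy, quadratic in [p - 1]. The constant 12 is [9 + 2 * (3 / 2)]. *)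
pose e := (p - 1) ^+ 2 * ((p + 2) * q / 2).
have -> : Phi (y * q) - Phi y + (p ^+ 2 - 1) / 2 * (y * phi y) =
    D + e * (y * phi y).
  have -> : e = (p ^+ 2 - 1) / 2 - (1 - q).
    by rewrite /e /q; field; rewrite gt_eqF.
  by rewrite /D; ring.
have [yphi _] := gauss_pdf_bounds13 y.
have pq3 : 0 <= (p + 2) * q / 2 <= 3 / 2.
  by rewrite mulrDl [p * q]mulrC qp; apply/andP; split; lra.
have e_ge0 : 0 <= e by rewrite mulr_ge0 ?sqr_ge0 //; case/andP: pq3.
have e_le : e <= (p - 1) ^+ 2 * (3 / 2).
  by rewrite ler_wpM2l ?sqr_ge0 //; case/andP: pq3.
have h1 : `|e * (y * phi y)| <= e * 2 by rewrite normrM ger0_norm // ler_wpM2l.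
have h2 : (p - 1) ^+ 2 <= (p ^+ 2 - 1) ^+ 2.
  rewrite lerXn2r ?nnegrE //; first by lra.
    by rewrite subr_ge0 expr_ge1 // ltW.
  by rewrite lerB // expr2 ler_peMl // ltW.
have := ler_normD D (e * (y * phi y)); lra.
Qed.

End GaussCalculus.

(** * Gaussian tails and smoothed indicators *)

Section GaussTails.
Local Open Scope classical_set_scope.
Variable R : realType.
Implicit Types x y t w q s u : R.
Local Notation Phi := (@gauss_cdf R).
Local Notation phi := (@gauss_pdf R).

Lemma expR_half_le1 : (1 : R) <= 2 * expR (- (1 ^+ 2) / 2).
Proof.
have h := expR_ge1Dx (- (1 ^+ 2) / 2 : R).
by rewrite expr1n in h *; lra.
Qed.

Lemma is_derive_tail (a b : R) x :
  is_derive x 1 (fun w => a * Phi w + b * expR (- (w ^+ 2) / 2))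
    (a * phi x - b * (x * expR (- (x ^+ 2) / 2))).
Proof.
have h1 := is_derive_gauss_cdf x; have h2 := is_derive_expsq x.
by apply: is_derive_eq; rewrite /GRing.scale /=; ring.
Qed.

Lemma gauss_pdf_le_exp x : phi x <= expR (- (x ^+ 2) / 2).
Proof. by rewrite /gauss_pdf ler_piMl ?expR_ge0 // gauss_c_le1. Qed.

(** For [w <= 1] the right side is at least 1. Beyond 1, left minus right side is nondecreasing,
    since [phi x <= x * expR (- (x ^+ 2) / 2)]; a positive value [e] would persist up to a point [N]
    with [1 - Phi N < e]. *)
Lemma gauss_cdf_upper_tail w : 0 <= w -> 1 - Phi w <= 2 * expR (- (w ^+ 2) / 2).
Proof.
move=> w0; have [w1|w1] := leP w 1.
  apply: (@le_trans _ _ 1); first by have := gauss_cdf_ge0 w; lra.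
  apply: le_trans expR_half_le1 _; rewrite ler_pM2l // ler_expR.
  by rewrite ler_pM2r ?invr_gt0 // lerN2 lerXn2r ?nnegrE.
rewrite leNgt; apply/negP => lt_w.
pose e := 1 - Phi w - 2 * expR (- (w ^+ 2) / 2).
have e0 : 0 < e by rewrite /e; lra.
have [N [wN eN]] : exists N, w <= N /\ 1 - Phi N < e.
  have /cvgrPdist_lt /(_ e e0) near1 := @cvg_gauss_cdfy R.
  near (pinfty_nbhs R) => N; exists N; split.
    by near: N; apply: nbhs_pinfty_ge; exact: num_real.
  apply: le_lt_trans (ler_norm _) _; near: N; exact: near1.
have [c /andP[wc cN]] := mvt_ball wN (is_derive_tail (-1) (- 2)).
have p := gauss_pdf_le_exp c; have E0 := expR_ge0 (- (c ^+ 2) / 2).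
have c1 : 1 * expR (- (c ^+ 2) / 2) <= c * expR (- (c ^+ 2) / 2).
  by rewrite ler_wpM2r //; lra.
have : 0 <= (-1 * phi c - -2 * (c * expR (- c ^+ 2 / 2))) * (N - w).
  by rewrite mulr_ge0 //; lra.
move=> h E; have := expR_ge0 (- (N ^+ 2) / 2).
by move: h; rewrite -E /e in eN *; lra.
Unshelve. all: by end_near. Qed.

Lemma gauss_cdf_lower_tail w : w <= 0 -> Phi w <= 2 * expR (- (w ^+ 2) / 2).
Proof.
move=> w0; have [w1|w1] := leP (-1) w.
  apply: (@le_trans _ _ 1); first exact: gauss_cdf_le1.
  apply: le_trans expR_half_le1 _; rewrite ler_pM2l // ler_expR.
  rewrite ler_pM2r ?invr_gt0 // lerN2 -sqrrN lerXn2r ?nnegrE //; lra.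
rewrite leNgt; apply/negP => lt_w.
pose e := Phi w - 2 * expR (- (w ^+ 2) / 2).
have e0 : 0 < e by rewrite /e; lra.
have [N [wN eN]] : exists N, N <= w /\ Phi N < e.
  have /cvgrPdist_lt /(_ e e0) near0 := @cvg_gauss_cdfNy R.
  near (ninfty_nbhs R) => N; exists N; split.
    by near: N; apply: nbhs_ninfty_le; exact: num_real.
  apply: (@le_lt_trans _ _ `|0 - Phi N|); first by rewrite sub0r normrN ler_norm.
  by near: N; exact: near0.
have [c /andP[wc cN]] := mvt_ball wN (is_derive_tail 1 (- 2)).
have p := gauss_pdf_le_exp c; have E0 := expR_ge0 (- (c ^+ 2) / 2).
have c1 : c * expR (- (c ^+ 2) / 2) <= - 1 * expR (- (c ^+ 2) / 2).
  by rewrite ler_wpM2r //; lra.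
have : 0 <= (- (1 * phi c - -2 * (c * expR (- c ^+ 2 / 2)))) * (w - N).
  by rewrite mulr_ge0 //; lra.
move=> h E; have := expR_ge0 (- (N ^+ 2) / 2).
by rewrite /e in eN; move: h E; lra.
Unshelve. all: by end_near. Qed.

(** The interval has length 1 and centre [w / 2], so its points satisfy
    [c ^+ 2 <= (w ^+ 2 + 1) / 2]. *)
Lemma gauss_bump_ge w :
  gauss_c R * expR (- (1 / 4)) * expR (- (w ^+ 2) / 2) <=
  Phi ((w + 1) / 2) - Phi ((w - 1) / 2).
Proof.
have le_w : (w - 1) / 2 <= (w + 1) / 2 by lra.
have [c /andP[c1 c2] ->] := mvt_ball le_w (@is_derive_gauss_cdf R).
have -> : (w + 1) / 2 - (w - 1) / 2 = 1 by field.
rewrite mulr1 -mulrA -expRD ler_pM2l ?gauss_c_gt0 // ler_expR.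
have : 0 <= (c - (w - 1) / 2) * ((w + 1) / 2 - c) by rewrite mulr_ge0 // subr_ge0.
have := sqr_ge0 (w - c); have := sqr_ge0 c; have := sqr_ge0 w.
nra.
Qed.

Definition smooth_const : R := 2 / (gauss_c R * expR (- (1 / 4))).

Lemma smooth_const_ge0 : 0 <= smooth_const.
Proof. by rewrite divr_ge0 // mulr_ge0 ?expR_ge0 // ltW // gauss_c_gt0. Qed.

(* A Gaussian bump of twice the width dominates the tails of [Phi], so that the
   error of smoothing an indicator is itself a difference of smoothed indicators. *)
Lemma gauss_cdf_indic w :
  `|(0 <= w)%R%:R - Phi w| <= smooth_const * (Phi ((w + 1) / 2) - Phi ((w - 1) / 2)).
Proof.
have c0 : 0 < gauss_c R * expR (- (1 / 4)) by rewrite mulr_gt0 ?expR_gt0 // gauss_c_gt0.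
apply: (@le_trans _ _ (2 * expR (- (w ^+ 2) / 2))); last first.
  rewrite /smooth_const mulrAC ler_pdivlMr // -mulrA ler_pM2l //.
  by rewrite mulrC gauss_bump_ge.
have [w0|w0] := leP 0 w.
  by rewrite ger0_norm ?subr_ge0 ?gauss_cdf_le1 // gauss_cdf_upper_tail.
rewrite sub0r normrN ger0_norm ?gauss_cdf_ge0 //.
by rewrite gauss_cdf_lower_tail // ltW.
Qed.

Lemma gauss_cdf_lip x y : x <= y -> Phi y - Phi x <= y - x.
Proof.
move=> xy; have [c _ ->] := mvt_ball xy (@is_derive_gauss_cdf R).
have [p1 _ _] := gauss_pdf_bounds c.
by rewrite ler_piMl // subr_ge0.
Qed.

Lemma gauss_cdf_add_var x v D : 0 < v -> 0 <= D ->
  `|Phi (x * Num.sqrt v / Num.sqrt (D + v)) - Phi x| <= D / v + 12 * (D / v) ^+ 2.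
Proof.
move=> v0 D0; have s0 : 0 < Num.sqrt v by rewrite sqrtr_gt0.
have Dv0 : 0 < D + v by rewrite ltr_wpDl.
have r0 : 0 < Num.sqrt (D + v) by rewrite sqrtr_gt0.
pose p := Num.sqrt (D + v) / Num.sqrt v.
have p1 : 1 <= p by rewrite ler_pdivlMr // mul1r ler_wsqrtr // lerDr.
have p2 : p ^+ 2 - 1 = D / v.
  by rewrite /p expr_div_n !sqr_sqrtr ?ltW //; field; rewrite gt_eqF.
have -> : x * Num.sqrt v / Num.sqrt (D + v) = x / p.
  by rewrite /p; field; rewrite !gt_eqF.
have := gauss_cdf_scale x p1; rewrite {}p2; set th := D / v => h.
have th0 : 0 <= th by rewrite divr_ge0 // ltW.
have [yphi _] := gauss_pdf_bounds13 x.
have h2 : `|th / 2 * (x * phi x)| <= th / 2 * 2.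
  by rewrite normrM ger0_norm ?ler_wpM2l // divr_ge0.
have := ler_normB (Phi (x / p) - Phi x + th / 2 * (x * phi x))
  (th / 2 * (x * phi x)).
rewrite addrK; lra.
Qed.
End GaussTails.

(** * Lindeberg replacement *)

Lemma nstat_rows n (la : intpart n) : nstat la = (\sum_(k < n) k * rows la k)%N.
Proof.
rewrite /nstat (big_ord_widen _ (fun k => k * nth 0 la k)%N (intpart_size la)).
rewrite big_mkcond; apply: eq_bigr => k _.
by case: (ltnP k (size la)) => // sk; rewrite /rows (nth_default _ sk) muln0.
Qed.

(** Both sides add up the column indices of the boxes, by columns and by rows. *)
Lemma nstat_conj n (la : intpart n) :
  nstat (conj_intpart la) = (\sum_(k < n) 'C(rows la k, 2))%N.
Proof.
have le_head r : r \in (la : seq nat) -> (r <= head 0%N la)%N.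
  move=> /(nthP 0%N)[i _ <-]; rewrite -nth0; exact: (@rows_nonincr _ la 0%N i).
rewrite /nstat /= /conj_parts size_mkseq.
transitivity (\sum_(r <- la) 'C(r, 2))%N; last first.
  rewrite (big_nth 0%N) big_mkord.
  rewrite (big_ord_widen _ (fun k => 'C(nth 0%N la k, 2)) (intpart_size la)).
  rewrite big_mkcond; apply: eq_bigr => k _.
  by case: (ltnP k (size la)) => // sk; rewrite /rows (nth_default _ sk).
transitivity (\sum_(j < head 0%N la)
  \sum_(r <- la) (if (j < r)%N then j : nat else 0%N))%N.
  apply: eq_bigr => j _; rewrite nth_mkseq // -sum1_count big_distrr /=.
  by rewrite big_mkcond; apply: eq_bigr => r _; rewrite muln1.
rewrite exchange_big /=; apply: eq_big_seq => r /le_head rh.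
rewrite -big_mkcond -(big_ord_widen _ (fun j => j) rh).
by rewrite -(big_mkord xpredT (fun j => j)) bin2_sum.
Qed.

Section Step.
Variables (R : realType) (alpha : R).
Hypothesis alpha_gt0 : 0 < alpha.
Local Notation Phi := (@gauss_cdf R).
Local Notation phi := (@gauss_pdf R).

Lemma content_sumE n (la : intpart n) :
  alpha * (nstat (conj_intpart la))%:R - (nstat la)%:R = content_sum alpha n (rows la).
Proof.
rewrite nstat_conj nstat_rows !natr_sum mulr_sumr -sumrB.
by apply: eq_bigr => k _; rewrite natrM.
Qed.

Definition up_abs3 n f : R :=
  \sum_(i < n.+1) up_prob alpha n f i * `|content alpha f i| ^+ 3.

(** Twice the constant is [alpha] from the variance plus [alpha + 2 * alpha ^+ 2 + alpha ^+ 3] from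
    the fourth moment. *)
Definition abs3_const : R := (2 * alpha + 2 * alpha ^+ 2 + alpha ^+ 3) / 2.

(* AM-GM with the scale [s = sqrt N] bounds [|c|^3] by [(s c^2 + c^4 / s) / 2],
   whose expectation is known. *)
Lemma jack_exp_abs3 n N : (n <= N)%N -> (0 < N)%N ->
  jack_exp alpha n (up_abs3 n) <= abs3_const * (N%:R * Num.sqrt N%:R).
Proof.
move=> nN N0; set s := Num.sqrt N%:R.
have s0 : 0 < s by rewrite sqrtr_gt0 ltr0n.
have s2 : s ^+ 2 = N%:R by rewrite sqr_sqrtr.
have a0 := alpha_gt0.
apply: (@le_trans _ _ (jack_exp alpha n (fun f =>
   s / 2 * (alpha * n%:R) * 1 +
    (2 * s)^-1 * ((alpha * n%:R) ^+ 2 / 2 * 1 + 4^-1 * up_p4 alpha n f)))).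
  apply: le_jack_exp => // la; have [_ _ m2 m4] := rows_moments alpha_gt0 la.
  rewrite /up_abs3 mulr1 mulr1 [4^-1 * _]mulrC -m4 -m2 !mulr_sumr -big_split.
  apply: ler_sum => i _ /=.
  set p := up_prob _ _ _ _; set c := content _ _ _.
  have p0 : 0 <= p by apply: up_ge0 => //; [exact: rows_nonincr|rewrite -ltnS].
  have -> : s / 2 * (p * c ^+ 2) + (2 * s)^-1 * (p * c ^+ 4) =
      p * ((s ^+ 2 * `|c| ^+ 2 + `|c| ^+ 4) / (2 * s)).
    rewrite -!normrX ger0_norm ?sqr_ge0 // ger0_norm ?exprn_even_ge0 //.
    by field; rewrite gt_eqF.
  rewrite ler_wpM2l // ler_pdivlMr ?mulr_gt0 //.
  have := mulr_ge0 (sqr_ge0 `|c|) (sqr_ge0 (s - `|c|)); nra.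
rewrite jack_expD !jack_expZ jack_expD !jack_expZ jack_exp1 // jack_exp_p4 //.
have n0 : 0 <= n%:R :> R by [].
have nNR : n%:R <= N%:R :> R by rewrite ler_nat.
have n_sq : n%:R <= N%:R ^+ 2 :> R.
  by rewrite -natrX ler_nat (leq_trans nN) // leq_pmulr.
have n2 : n%:R ^+ 2 <= N%:R ^+ 2 :> R by rewrite lerXn2r ?nnegrE.
have -> : abs3_const * (N%:R * s) = (alpha * (N%:R * s ^+ 2) +
   (alpha + 2 * alpha ^+ 2 + alpha ^+ 3) * N%:R ^+ 2) / (2 * s).
  by rewrite /abs3_const -s2; field; rewrite gt_eqF.
rewrite ler_pdivlMr ?mulr_gt0 //.
set rhs := (X in _ <= X).
have -> : (s / 2 * (alpha * n%:R) * 1 +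
      (2 * s)^-1 * ((alpha * n%:R) ^+ 2 / 2 * 1 + 4^-1 *
        (6 * alpha ^+ 2 * n%:R * (n%:R - 1) +
          (4 * alpha ^+ 3 - 6 * alpha ^+ 2 + 4 * alpha) * n%:R))) * (2 * s) =
    alpha * n%:R * s ^+ 2 + (2 * alpha ^+ 2 * n%:R ^+ 2 +
      (alpha ^+ 3 - 3 * alpha ^+ 2 + alpha) * n%:R).
  by field; rewrite gt_eqF.
rewrite {}/rhs s2.
have h1 : alpha * n%:R * N%:R <= alpha * (N%:R * N%:R).
  by rewrite -mulrA ler_pM2l // ler_wpM2r.
have h2 := ler_wpM2l (mulr_ge0 (ler0n R 2) (sqr_ge0 alpha)) n2.
have h3 := ler_wpM2l (addr_ge0 (exprn_ge0 3 (ltW a0)) (ltW a0)) n_sq.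
have h4 := mulr_ge0 (sqr_ge0 alpha) n0.
lra.
Qed.

(** A box is compared with a centred Gaussian of variance [alpha * n]. Both are expanded at [y], and
    by [rows_moments] the terms up to second order cancel; the two remainders make up the bound. *)
Lemma lindeberg_step n (la : intpart n) (x v : R) : 0 < v ->
  `|\sum_(i < n.+1) up_prob alpha n (rows la) i *
      Phi ((x - (content_sum alpha n (rows la) + content alpha (rows la) i)) /
        Num.sqrt v)
    - Phi ((x - content_sum alpha n (rows la)) / Num.sqrt (v + alpha * n%:R))|
  <= 3 / Num.sqrt v ^+ 3 * up_abs3 n (rows la) + 12 * (alpha * n%:R / v) ^+ 2.
Proof.
move=> v0; set f := rows la; set s := content_sum _ _ _.
have a0 := alpha_gt0.
have an0 : 0 <= alpha * n%:R by rewrite mulr_ge0 // ltW.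
pose r := Num.sqrt v; have r0 : 0 < r by rewrite sqrtr_gt0.
have r2 : r ^+ 2 = v by rewrite sqr_sqrtr // ltW.
pose r' := Num.sqrt (v + alpha * n%:R).
have r'2 : r' ^+ 2 = v + alpha * n%:R by rewrite sqr_sqrtr // addr_ge0 // ltW.
pose y := (x - s) / r; pose p := r' / r.
have p1 : 1 <= p by rewrite ler_pdivlMr // mul1r ler_wsqrtr // lerDl.
have p2 : p ^+ 2 - 1 = alpha * n%:R / v.
  by rewrite /p expr_div_n r'2 r2; field; rewrite gt_eqF.
have r'0 : 0 < r' by rewrite sqrtr_gt0 ltr_pwDl.
have [m0 m1 m2 _] := rows_moments alpha_gt0 la.
rewrite -/f in m0 m1 m2.
have -> : (x - s) / r' = y / p by rewrite /y /p; field; rewrite !gt_eqF.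
pose T i := Phi (y - content alpha f i / r) - Phi y + content alpha f i / r * phi y +
   (content alpha f i / r) ^+ 2 / 2 * (y * phi y).
have -> : \sum_(i < n.+1) up_prob alpha n f i *
      Phi ((x - (s + content alpha f i)) / r) - Phi (y / p) =
    \sum_(i < n.+1) up_prob alpha n f i * T i
     - (Phi (y / p) - Phi y + (p ^+ 2 - 1) / 2 * (y * phi y)).
  have -> : \sum_(i < n.+1) up_prob alpha n f i * T i =
     \sum_(i < n.+1) up_prob alpha n f i * Phi ((x - (s + content alpha f i)) / r)
     - Phi y * \sum_(i < n.+1) up_prob alpha n f i
     + phi y / r * \sum_(i < n.+1) up_prob alpha n f i * content alpha f i
     + y * phi y / (2 * v) *
       \sum_(i < n.+1) up_prob alpha n f i * content alpha f i ^+ 2.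
    rewrite !mulr_sumr -sumrB -!big_split; apply: eq_bigr => i _ /=.
    have -> : (x - (s + content alpha f i)) / r = y - content alpha f i / r.
      by rewrite /y; ring.
    by rewrite /T -r2; field; rewrite gt_eqF.
  by rewrite m0 m1 m2 p2; field; rewrite !gt_eqF.
apply: le_trans (ler_normB _ _) _; apply: lerD; last first.
  by rewrite -p2; exact: gauss_cdf_scale.
apply: le_trans (ler_norm_sum _ _ _) _; rewrite /up_abs3 mulr_sumr.
apply: ler_sum => i _; rewrite normrM ger0_norm; last first.
  by apply: up_ge0 => //; [exact: rows_nonincr|rewrite -ltnS].
rewrite mulrCA ler_wpM2l //.
  by apply: up_ge0 => //; [exact: rows_nonincr|rewrite -ltnS].
apply: le_trans (gauss_cdf_taylor _ _) _.
by rewrite normrM normfV (ger0_norm (ltW r0)) expr_div_n mulrA mulrAC.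
Qed.
End Step.

(** * Total replacement error and removal of the smoothing *)

Section Main.
Variables (R : realType) (alpha : R).
Hypothesis alpha_gt0 : 0 < alpha.
Local Notation Phi := (@gauss_cdf R).
Let a0 := alpha_gt0.

Definition pairs_var k : R := alpha * (k%:R * (k%:R - 1) / 2).

Lemma pairs_varS k : pairs_var k.+1 = pairs_var k + alpha * k%:R.
Proof. by rewrite /pairs_var -natr1; field. Qed.

Lemma pairs_var_le k m : (k <= m)%N -> pairs_var k <= pairs_var m.
Proof.
elim: m => [|m IH]; first by rewrite leqn0 => /eqP ->.
rewrite leq_eqVlt => /orP[/eqP->//|/IH h]; rewrite pairs_varS.
by rewrite (le_trans h) // lerDl mulr_ge0 // ltW.
Qed.

Lemma pairs_var_binE n : pairs_var n = alpha * 'C(n, 2)%:R.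
Proof.
elim: n => [|n IH]; first by rewrite /pairs_var bin0n /= mulr0 mul0r mul0r mulr0.
by rewrite pairs_varS IH binS bin1 natrD; ring.
Qed.

(** The distribution function of [content_sum] plus an independent centred Gaussian of standard
    deviation [d]. *)
Definition smoothed_cdf n d (x : R) : R :=
  jack_exp alpha n (fun f => Phi ((x - content_sum alpha n f) / d)).

(** [v k] is the Gaussian variance left once [k] boxes are placed: the total stays
    [D + pairs_var n], purely Gaussian at [k = 0], and the step errors telescope. *)
Lemma lindeberg_sum D n m (x : R) (v := fun k => D + pairs_var n - pairs_var k) :
  0 < D -> (m <= n)%N ->
  `|smoothed_cdf m (Num.sqrt (v m)) x - Phi (x / Num.sqrt (v 0%N))| <=
  \sum_(k < m) (3 / Num.sqrt (v k.+1) ^+ 3 * jack_exp alpha k (up_abs3 alpha k)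
     + 12 * (alpha * k%:R / v k.+1) ^+ 2).
Proof.
move=> D0; have v_gt0 k : (k <= n)%N -> 0 < v k.
  by move=> /pairs_var_le; rewrite /v; lra.
elim: m => [|m IH] mn.
  rewrite /smoothed_cdf jack_exp0 // big_ord0 /content_sum big_ord0.
  by rewrite subr0 subrr normr0.
rewrite big_ord_recr /= [smoothed_cdf m.+1 _ _]jack_exp_recr //.
set G := fun f => \sum_(i < m.+1) _.
pose F f := Phi ((x - content_sum alpha m f) / Num.sqrt (v m)).
have -> : jack_exp alpha m G - Phi (x / Num.sqrt (v 0%N)) =
  (jack_exp alpha m F - Phi (x / Num.sqrt (v 0%N))) +
  jack_exp alpha m (fun f => G f - F f).
  by rewrite jack_expB; ring.
apply: le_trans (ler_normD _ _) _; apply: lerD; first exact: IH (ltnW mn).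
apply: le_trans (ler_norm_jack_exp _ _ _) _ => //.
set E := (alpha * m%:R / v m.+1) ^+ 2.
have -> : 12 * E = jack_exp alpha m (fun=> 12 * E * 1).
  by rewrite jack_expZ jack_exp1 // mulr1.
rewrite -jack_expZ -jack_expD.
apply: le_jack_exp => // la; rewrite mulr1.
have vm : v m = v m.+1 + alpha * m%:R by rewrite /v pairs_varS; ring.
have -> : G (rows la) = \sum_(i < m.+1) up_prob alpha m (rows la) i * Phi
    ((x - (content_sum alpha m (rows la) + content alpha (rows la) i)) /
      Num.sqrt (v m.+1)).
  by apply: eq_bigr => i _; rewrite content_sum_addrow ?rows_eq0 // -ltnS.
rewrite /F vm; exact: (lindeberg_step alpha_gt0 la x (v_gt0 _ mn)).
Qed.

(** Comparison with a telescoping sum: for consecutive roots, [c ^+ 2 = b ^+ 2 + 1] gives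
    [b^-1 - c^-1 = (b * c * (b + c))^-1], and [c <= 2 * b] bounds that denominator by
    [6 * b ^+ 3]. *)
Lemma sum_inv_cube L n : 1 <= L ->
  \sum_(m < n) (Num.sqrt (L + m%:R) ^+ 3)^-1 <= 6 / Num.sqrt L :> R.
Proof.
move=> L1; pose a m := Num.sqrt (L + m%:R).
have a1 m : 1 <= a m.
  have h : 1 <= L + m%:R by have := ler0n R m; lra.
  by have := ler_wsqrtr h; rewrite sqrtr1.
have a2 m : a m ^+ 2 = L + m%:R.
  by rewrite sqr_sqrtr //; have := ler0n R m; lra.
suff : \sum_(m < n) (a m ^+ 3)^-1 <= 6 * ((a 0%N)^-1 - (a n)^-1).
  move/le_trans; apply; rewrite /a addr0 ler_pM2l // gerBl invr_ge0.
  exact: sqrtr_ge0.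
elim: n => [|n IH]; first by rewrite big_ord0 subrr mulr0.
rewrite big_ord_recr /=.
suff : (a n ^+ 3)^-1 <= 6 * ((a n)^-1 - (a n.+1)^-1) by lra.
have := a1 n; have := a1 n.+1; have := a2 n; have := a2 n.+1.
rewrite -natr1; move: (a n) (a n.+1) => b c c2 b2 c1 b1.
have c2b : c ^+ 2 = b ^+ 2 + 1 by lra.
have cb : c <= 2 * b.
  by rewrite -(ler_pXn2r (n := 2)) ?nnegrE //; nra.
have -> : b^-1 - c^-1 = (b * c * (b + c))^-1.
  have bc : (c - b) * (b + c) = 1 by rewrite mulrC; nra.
  have -> : b^-1 - c^-1 = (c - b) * (b + c) / (b * c * (b + c)).
    by field; rewrite !gt_eqF //; lra.
  by rewrite bc div1r.
rewrite -[6]invrK -invfM lef_pV2 ?posrE ?mulr_gt0 ?exprn_gt0 ?invr_gt0 //; try lra.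
by rewrite mulrC ler_pdivrMr //; nra.
Qed.
Lemma abs3_const_ge0 : 0 <= abs3_const alpha.
Proof.
have h2 := sqr_ge0 alpha; have h3 := exprn_ge0 3 (ltW a0).
by rewrite /abs3_const; have := a0; lra.
Qed.

Definition smooth_rate : R :=
  (3 * abs3_const alpha / Num.sqrt (alpha / 2) ^+ 3 + 48) * 6.

(** The remaining variance is [alpha / 2 * (n - k - 1) * (n + k)], where [n + k] is bounded below by
    [n]. *)
Lemma pairs_var_gap n k (L := Num.sqrt n%:R : R) D : (k < n)%N ->
    alpha * n%:R / 2 * L <= D ->
  alpha / 2 * n%:R * (L + (n - k.+1)%:R) <= D + pairs_var n - pairs_var k.+1.
Proof.
move=> kn DL; rewrite natrB // /pairs_var -[k.+1%:R]natr1.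
have kn' : k%:R + 1 <= n%:R :> R by rewrite natr1 ler_nat.
have k0 : 0 <= k%:R :> R by [].
suff : 0 <= alpha * (k%:R * (n%:R - (k%:R + 1))) by lra.
by rewrite mulr_ge0 ?mulr_ge0 ?subr_ge0 // ltW.
Qed.

Lemma smooth_bound n D (x : R) : (0 < n)%N ->
    alpha * n%:R / 2 * Num.sqrt n%:R <= D ->
  `|smoothed_cdf n (Num.sqrt D) x - Phi (x / Num.sqrt (D + pairs_var n))| <=
  smooth_rate / Num.sqrt (Num.sqrt n%:R).
Proof.
move=> n0; set L : R := Num.sqrt n%:R => DL.
have nR : 1 <= n%:R :> R by rewrite ler1n.
have L1 : 1 <= L by have := ler_wsqrtr nR; rewrite sqrtr1.
have L2 : n%:R = L ^+ 2 by rewrite sqr_sqrtr.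
have D0 : 0 < D.
  by apply: lt_le_trans DL; rewrite !mulr_gt0 ?invr_gt0 ?ltr0n //; lra.
have := lindeberg_sum x D0 (leqnn n).
rewrite addrK [pairs_var 0]/pairs_var mul0r mul0r mulr0 subr0.
move/le_trans; apply.
pose c := 3 * abs3_const alpha / Num.sqrt (alpha / 2) ^+ 3 + 48.
(* With [n = L ^+ 2], the variance is at least [(g * L * b) ^+ 2] and the third moment at most a
   multiple of [L ^+ 3], so the powers of [L] cancel. The quadratic errors are at most
   [12 * 4 / b ^+ 4], and [b >= 1] lowers the exponent to 3. *)
apply: (@le_trans _ _ (\sum_(k < n) c * (Num.sqrt (L + (n - k.+1)%:R) ^+ 3)^-1)).
  apply: ler_sum => k _; set b := Num.sqrt (L + _).
  have m0 : 0 <= (n - k.+1)%:R :> R by [].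
  have b2 : b ^+ 2 = L + (n - k.+1)%:R by rewrite sqr_sqrtr //; lra.
  have b1 : 1 <= b.
    have h : 1 <= L + (n - k.+1)%:R by lra.
    by have := ler_wsqrtr h; rewrite sqrtr1.
  set v := D + _ - _.
  have v_ge : alpha / 2 * n%:R * b ^+ 2 <= v.
    by rewrite b2; exact: pairs_var_gap (ltn_ord k) DL.
  pose g := Num.sqrt (alpha / 2).
  have g0 : 0 < g by rewrite sqrtr_gt0 divr_gt0.
  have g2 : g ^+ 2 = alpha / 2 by rewrite sqr_sqrtr // divr_ge0 // ltW.
  have gLb : 0 < g * L * b by rewrite !mulr_gt0 //; lra.
  have w_ge : g * L * b <= Num.sqrt v.
    have -> : g * L * b = Num.sqrt ((g * L * b) ^+ 2).
      by rewrite sqrtr_sqr ger0_norm // ltW.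
    by apply: ler_wsqrtr; rewrite !exprMn g2 -L2.
  rewrite /c [X in _ <= X]mulrDl; apply: lerD.
    have J_le := jack_exp_abs3 alpha_gt0 (ltnW (ltn_ord k)) n0.
    have w0 : 0 < Num.sqrt v by exact: lt_le_trans w_ge.
    apply: (@le_trans _ _ (3 / Num.sqrt v ^+ 3 * (abs3_const alpha * L ^+ 3))).
      rewrite ler_wpM2l //.
      by rewrite (le_trans J_le) // -/L L2 -exprSr.
    apply: (@le_trans _ _ (3 / (g * L * b) ^+ 3 * (abs3_const alpha * L ^+ 3))).
      apply: ler_wpM2r.
        by apply: mulr_ge0; [exact: abs3_const_ge0|rewrite exprn_ge0 // sqrtr_ge0].
      by rewrite ler_pM2l // lef_pV2 ?posrE ?exprn_gt0 // lerXn2r ?nnegrE // ltW.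
    rewrite le_eqVlt; apply/orP; left; apply/eqP.
    by rewrite -/g; field; rewrite !gt_eqF //; lra.
  have b0 : 0 < b by lra.
  have v0 : 0 < v.
    by apply: lt_le_trans v_ge; rewrite !mulr_gt0 ?exprn_gt0 ?invr_gt0 ?ltr0n.
  have q_le : alpha * k%:R / v <= 2 / b ^+ 2.
    rewrite ler_pdivrMr // mulrAC ler_pdivlMr ?exprn_gt0 //.
    have kn : alpha * k%:R * b ^+ 2 <= alpha * n%:R * b ^+ 2.
      by rewrite ler_pM2r ?exprn_gt0 // ler_pM2l // ler_nat ltnW.
    lra.
  have q0 : 0 <= alpha * k%:R / v by rewrite divr_ge0 ?(ltW v0) // mulr_ge0 // ltW.
  have qb : (alpha * k%:R / v) ^+ 2 <= (2 / b ^+ 2) ^+ 2.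
    by rewrite lerXn2r ?nnegrE // (le_trans q0).
  have b34 : (b ^+ 4)^-1 <= (b ^+ 3)^-1.
    by rewrite lef_pV2 ?posrE ?exprn_gt0 // ler_weXn2l.
  have -> : 48 * (b ^+ 3)^-1 = 12 * (4 * (b ^+ 3)^-1) by ring.
  rewrite ler_pM2l //; apply: (le_trans qb).
  have -> : (2 / b ^+ 2) ^+ 2 = 4 * (b ^+ 4)^-1 by field; rewrite gt_eqF.
  by rewrite ler_pM2l.
rewrite -mulr_sumr /smooth_rate -/c -[c * 6 / _]mulrA ler_wpM2l //.
  rewrite addr_ge0 // mulr_ge0 //.
  by rewrite mulr_ge0 // abs3_const_ge0.
rewrite (reindex_inj rev_ord_inj) /=.
rewrite (eq_bigr (fun m : 'I_n => (Num.sqrt (L + m%:R) ^+ 3)^-1)).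
  exact: sum_inv_cube.
by move=> m _; rewrite subnSK // subKn // ltnW.
Qed.

Lemma powR_quarter n : n%:R `^ (- (1 / 4)) = (Num.sqrt (Num.sqrt n%:R))^-1 :> R.
Proof.
rewrite powRN -!powR12_sqrt ?powR_ge0 // -powRrM.
by do 2 congr (_ _); field.
Qed.

Definition content_cdf n (x : R) : R :=
  jack_exp alpha n (fun f => (content_sum alpha n f <= x)%R%:R).

(** The right side contains smoothed laws only, which [smooth_bound] controls, so no prior bound on
    the concentration of [content_sum] is required. *)
Lemma content_cdf_smooth n d (x : R) : 0 < d ->
  `|content_cdf n x - smoothed_cdf n d x| <=
  smooth_const R * (smoothed_cdf n (2 * d) (x + d) - smoothed_cdf n (2 * d) (x - d)).
Proof.
move=> d0; rewrite /content_cdf /smoothed_cdf -!jack_expB -jack_expZ.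
apply: le_trans (ler_norm_jack_exp alpha_gt0 _ _) _.
apply: le_jack_exp => // la; set S := content_sum _ _ _.
have := gauss_cdf_indic ((x - S) / d); rewrite ler_pdivlMr // mul0r subr_ge0.
have -> : ((x - S) / d + 1) / 2 = (x + d - S) / (2 * d) by field; rewrite gt_eqF.
by have -> : ((x - S) / d - 1) / 2 = (x - d - S) / (2 * d) by field; rewrite gt_eqF.
Qed.

Lemma jack_probE n (x0 : R) : (2 <= n)%N ->
  jack_prob alpha (fun la : intpart n => W alpha la <= x0) =
  content_cdf n (x0 * Num.sqrt (pairs_var n)).
Proof.
move=> n2; rewrite /jack_prob /content_cdf /jack_exp big_mkcond.
apply: eq_bigr => la _; rewrite /W content_sumE -pairs_var_binE ler_pdivrMr.
  by case: ifP => _; rewrite ?mulr1 ?mulr0.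
by rewrite sqrtr_gt0 pairs_var_binE mulr_gt0 // ltr0n bin_gt0.
Qed.

Lemma pairs_var_ge n : (2 <= n)%N -> alpha * n%:R * n%:R / 4 <= pairs_var n.
Proof.
move=> n2; have nR : 0 <= n%:R - 2 :> R by rewrite subr_ge0 ler_nat.
have := mulr_ge0 (mulr_ge0 (ltW a0) (ler0n R n)) nR; rewrite /pairs_var; lra.
Qed.

(** Each smoothed law is replaced by a Gaussian of standard deviation [sg] at cost
    [smooth_rate / l]. As [Phi] is 1-Lipschitz, the Gaussian increment is at most [2 * d / sg],
    where [d] has order [n^(3/4)] and [sg] at least order [n]. *)
Lemma smooth_cdf_increment n d (x : R) (l : R := Num.sqrt (Num.sqrt n%:R)) :
    (2 <= n)%N -> 0 < d -> d ^+ 2 = alpha * n%:R / 2 * Num.sqrt n%:R ->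
  smoothed_cdf n (2 * d) (x + d) - smoothed_cdf n (2 * d) (x - d) <=
  (4 + 2 * smooth_rate) / l.
Proof.
move=> n2 d0 d2; have n0 : (0 < n)%N by exact: ltnW.
have L2 : Num.sqrt n%:R ^+ 2 = n%:R :> R by rewrite sqr_sqrtr.
have l0 : 0 < l by rewrite !sqrtr_gt0 ltr0n.
have l2 : l ^+ 2 = Num.sqrt n%:R by rewrite sqr_sqrtr // sqrtr_ge0.
have n20 : 0 <= n%:R ^+ 2 :> R by exact: sqr_ge0.
have an20 : 0 <= alpha * n%:R ^+ 2 by rewrite mulr_ge0 // ltW.
have pv_ge := pairs_var_ge n2.
pose D := (2 * d) ^+ 2.
have DE : Num.sqrt D = 2 * d by rewrite sqrtr_sqr ger0_norm // mulr_ge0 // ltW.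
have Dd : alpha * n%:R / 2 * Num.sqrt n%:R <= D.
  by rewrite -d2 /D exprMn; have := sqr_ge0 d; lra.
have D0 : 0 <= D by exact: sqr_ge0.
have smp := smooth_bound (x + d) n0 Dd; have smm := smooth_bound (x - d) n0 Dd.
rewrite DE -/l in smp smm.
pose sg := Num.sqrt (D + pairs_var n); rewrite -/sg in smp smm.
have pv0 : 0 < pairs_var n.
  by apply: lt_le_trans pv_ge; rewrite divr_gt0 // !mulr_gt0 // ltr0n.
have sg0 : 0 < sg by rewrite sqrtr_gt0 ltr_wpDl.
have dl : d ^+ 2 * l ^+ 2 = alpha * n%:R * n%:R / 2.
  rewrite d2 l2; transitivity (alpha * n%:R / 2 * Num.sqrt n%:R ^+ 2); first by ring.
  by rewrite L2; ring.
have d_sg : d <= 2 / l * sg.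
  rewrite mulrAC ler_pdivlMr // -(ler_pXn2r (n := 2)) ?nnegrE //; first last.
  - by rewrite mulr_ge0 // ltW.
  - by rewrite mulr_ge0 // ltW.
  rewrite exprMn [(2 * sg) ^+ 2]exprMn dl sqr_sqrtr ?addr_ge0 ?(ltW pv0) //.
  by move: pv_ge D0 an20; clear; lra.
have Phi_diff : Phi ((x + d) / sg) - Phi ((x - d) / sg) <= 4 / l.
  have h : (x - d) / sg <= (x + d) / sg.
    by rewrite ler_pM2r ?invr_gt0 //; move: d0; lra.
  apply: (le_trans (gauss_cdf_lip h)).
  by rewrite -mulrBl ler_pdivrMr //; move: d_sg; lra.
move: smp smm Phi_diff; rewrite !ler_norml => /andP[_ h1] /andP[h2 _].
by rewrite [(4 + _) / l]mulrDl; move: h1 h2; clear; lra.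
Qed.

(** The summands pay for smoothing the indicator, for the replacement and for the additional
    variance. The last is [th + 12 * th ^+ 2] with [th <= 2 / L <= 2], hence at most
    [25 * th <= 50 / l]. *)
Definition jack_rate : R :=
  smooth_const R * (4 + 2 * smooth_rate) + smooth_rate + 50.

Lemma jack_clt n (x0 : R) : (2 <= n)%N ->
  `|jack_prob alpha (fun la : intpart n => W alpha la <= x0) - Phi x0|
  <= jack_rate / Num.sqrt (Num.sqrt n%:R).
Proof.
move=> n2; have n0 : (0 < n)%N by exact: ltnW.
rewrite jack_probE //; set x := x0 * _.
set L : R := Num.sqrt n%:R; set l := Num.sqrt L.
have nR : 1 <= n%:R :> R by rewrite ler1n.
have L1 : 1 <= L by have := ler_wsqrtr nR; rewrite sqrtr1.
have L2 : L ^+ 2 = n%:R by rewrite sqr_sqrtr.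
have l1 : 1 <= l by have := ler_wsqrtr L1; rewrite sqrtr1.
have L0 : 0 < L by exact: lt_le_trans L1.
have l0 : 0 < l by exact: lt_le_trans l1.
have l2 : l ^+ 2 = L by rewrite sqr_sqrtr // ltW.
have lL : l <= L by rewrite -l2 expr2 ler_peMl // ltW.
have an0 : 0 < alpha * n%:R by rewrite mulr_gt0 ?ltr0n.
have pv_ge := pairs_var_ge n2.
have pv0 : 0 < pairs_var n.
  by apply: lt_le_trans pv_ge; rewrite divr_gt0 // mulr_gt0 // ltr0n.
pose D := alpha * n%:R / 2 * L.
have D0 : 0 < D by rewrite !mulr_gt0 ?invr_gt0 // ltr0n.
pose d := Num.sqrt D; have d0 : 0 < d by rewrite sqrtr_gt0.
have d2 : d ^+ 2 = D by rewrite sqr_sqrtr // ltW.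
have sm := smooth_bound x n0 (lexx D); rewrite -/d -/L -/l in sm.
have incr := smooth_cdf_increment x n2 d0 d2; rewrite -/L -/l in incr.
have var : `|Phi (x / Num.sqrt (D + pairs_var n)) - Phi x0| <= 50 / l.
  apply: le_trans (gauss_cdf_add_var x0 pv0 (ltW D0)) _; set th := D / _.
  have th_le : th <= 2 / L.
    rewrite ler_pdivrMr // mulrAC ler_pdivlMr //.
    have -> : D * L = alpha * n%:R * n%:R / 2 by rewrite /D -L2; ring.
    by move: pv_ge; clear; lra.
  have L_inv : 2 / L <= 2 / l by rewrite ler_pM2l // lef_pV2.
  have L_inv2 : 2 / L <= 2 by rewrite ler_pdivrMr // ler_peMr.
  have th0 : 0 <= th by rewrite divr_ge0 // ltW.
  have h3 : th ^+ 2 <= 2 * th by rewrite expr2 ler_wpM2r // (le_trans th_le).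
  by move: th_le L_inv h3; clear; lra.
have -> : content_cdf n x - Phi x0 = (content_cdf n x - smoothed_cdf n d x) +
   (smoothed_cdf n d x - Phi (x / Num.sqrt (D + pairs_var n))) +
   (Phi (x / Num.sqrt (D + pairs_var n)) - Phi x0) by ring.
rewrite [jack_rate / l]mulrDl [_ / l in X in _ <= X + _]mulrDl.
apply: (le_trans (ler_normD _ _)); apply: lerD => //.
apply: (le_trans (ler_normD _ _)); apply: lerD => //.
apply: (le_trans (content_cdf_smooth _ _ d0)); rewrite -[_ / l]mulrA.
by rewrite ler_wpM2l // smooth_const_ge0.
Qed.
End Main.

Theorem theorem1p2 (R : realType) (alpha : R) (halpha : 1 <= alpha) :
  exists A : R, forall (n : nat) (x0 : R), (2 <= n)%N ->
    `| jack_prob alpha (fun la : intpart n => W alpha la <= x0)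
       - gauss_cdf x0 | <= A * n%:R `^ (- (1 / 4)).
Proof.
exists (jack_rate alpha) => n x0 n2; rewrite powR_quarter.
exact: (jack_clt (lt_le_trans ltr01 halpha)).
Qed.
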